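(* For every positive integer $n$ there is a set $A_n$ of $n$ positive integers such that every sum-free subset of $A_n$ has size at most $\frac{1}{3}n + o(n)$, where $o(n)$ denotes a quantity (depending only on $n$) whose ratio to $n$ tends to $0$ as $n \to \infty$.
   Context: A set $A'$ of integers is called sum-free if there are no solutions to $x+y=z$ with $x,y,z\in A'$ (here $x=y$ is allowed). *)

(* Defs.v *)
From mathcomp Require Import all_boot all_order all_algebra finmap.

Set Implicit Arguments.
Unset Strict Implicit.
Unset Printing Implicit Defensive.

Local Open Scope ring_scope.

(* x, y and z need not be distinct; in particular x = y is allowed. *)
Definition sum_free (A : {fset int}) : Prop :=
  forall x y z : int, x \in A -> y \in A -> z \in A -> x + y <> z.

(* Main.v *)
Require Import Defs.
From mathcomp Require Import all_boot all_order all_algebra all_fingroup finmap.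
From mathcomp Require Import zify ring lra.
Import Order.TTheory GRing.Theory Num.Theory.
Set Implicit Arguments.
Unset Strict Implicit.
Unset Printing Implicit Defensive.

(** Why the theorem is true.

    Reduction to one inequality.  Let A be a finite set of positive integers
    which is almost invariant under dilation by each z <= N; such sets exist
    because the sets of products of at most E copies of each number up to N
    grow only polynomially with E ([folner]).  Let A' be a sum-free subset of
    A.  For y in A the set S_y = {k : k y in A'} is sum-free, and a fixed z
    with 0 < z <= N belongs to S_y for about |A'| of the |A| elements y.  So
    an inequality between averages of the indicator function of S, valid for
    every sum-free set S of integers, becomes a bound on |A'| when it is
    averaged over the sets S_y.  The inequality is [scale_average]:

      (mean over pairs (r, c) of the density of S on {H^a i : i < H^b})
        + 2 (density of S on [0, N)) <= 1 + eps,

    where a and b depend on (r, c).  Its left side has total weight 3, hence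
    3 |A'| <= (1 + 2 eps) |A|, say ([exists_no_large_sumfree]).  Disjoint
    dilates of A and a few more integers give sets of every large size
    ([exists_all_sizes]).

    The inequality inside a block.  View V = S /\ [0, N) in Z/N and let
    corr t be the density of V /\ (V - t).  If t is in S and small then
    corr t is almost 0.  Fix m = H^a and cut the multiples of m into blocks
    of n consecutive ones.  Let T be the set of positions in Z/n of the
    elements of S in one block; for a base point x let B_x and C_x be the
    sets of positions of V in the blocks at x and at x + (start of the block
    of T).  Without wrap-around modulo n, the sums T + B_x would avoid C_x
    for most x, and a robust form of the Cauchy-Davenport theorem
    ([pollard], [cyclic_sumset_inequality]), which holds in Z/n as soon as n
    has no small prime factor, would give |T| + |B_x| + |C_x| <= (1 + eps) n.
    The mean over x is the inequality wanted ([block_inequality]).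

    Two points remain.  First, the sums that do wrap around are harmless if
    corr (t - m n) is close to corr t for most t.  Second, |B_x| and |C_x|
    have to be close for most x, since the inequality in Z/n is useless when
    one of the sets is almost empty.

    For the first point, up to a small mean square error most of the functions
    t |-> corr (t - y) are determined by boundedly many bits, whatever V is
    ([sampling]).  Hence among many shifts y_b = Y H^b most y_a have a
    partner y_b, b > a, with nearly the same function ([few_nonrecurrent]).
    Now y_b - y_a = m n with n = Y (H^(b-a) - 1), and with Y = 1 + H^y and H
    divisible by all small integers, n is congruent to -1 modulo each of them,
    so it has no small factor ([rough_power]).  This is the reason for using
    powers of a highly divisible H.

    The partner relation is obtained in mean over the multiples of a power
    of H coarser than m, and is needed in a block of multiples of m.  An
    energy increment argument passes from one to the other, and settles the
    second point as well: the mean square of block averages increases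
    when blocks get shorter and their step more divisible ([tile_gap]), and
    it is at most 1; so along a long chain of scales it is nearly constant
    in most places, and then all block averages in between are close to each
    other ([block_close]).  It is applied to the translates of V and to
    their tensor squares. *)

(** * A robust Cauchy-Davenport inequality *)

Local Open Scope nat_scope.
Section Pollard.
Variable G : finZmodType.
Implicit Types A B C D E : {set G}.

Definition reps A B (x : G) : nat := \sum_(y : G) (y \in A) * ((x - y)%R \in B).

Lemma repsC A B x : reps A B x = reps B A x.
Proof.
rewrite /reps (reindex_inj (h := fun y => (x - y)%R)) /=; last first.
  by move=> y z /addrI /oppr_inj.
by apply: eq_bigr => y _; rewrite subKr mulnC.
Qed.

Lemma reps_leq A B x : reps A B x <= #|B|.
Proof.
rewrite repsC /reps -sum1_card [leqRHS]big_mkcond /= leq_sum // => y _.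
by case: (y \in B); case: (_ \in A).
Qed.

Lemma sum_reps A B : \sum_x reps A B x = #|A| * #|B|.
Proof.
rewrite /reps exchange_big /= -[#|A|]sum1_card big_distrl /= [RHS]big_mkcond /=.
apply: eq_bigr => y _; rewrite -big_distrr /=.
case: (y \in A); rewrite ?mul0n // !mul1n.
rewrite (reindex_inj (addIr y)) /= -sum1_card [RHS]big_mkcond /=.
by apply: eq_bigr => x _; rewrite addrK; case: (x \in B).
Qed.

Lemma repsUl C D E x : [disjoint C & D] ->
  reps (C :|: D) E x = reps C E x + reps D E x.
Proof.
move=> dCD; rewrite /reps -big_split /=; apply: eq_bigr => y _.
rewrite -mulnDl; congr (_ * _)%N; rewrite inE.
by have := disjointFr dCD (x := y); case: (y \in C) => // -> //.
Qed.

Lemma repsUr C D E x : [disjoint C & D] ->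
  reps E (C :|: D) x = reps E C x + reps E D x.
Proof. by move=> dCD; rewrite repsC repsUl // !(repsC E). Qed.

(** Replacing (A, B) by (A u B, A n B) loses exactly the sums of A - B and B -
    A: the mixed terms cancel because addition is commutative. *)
Lemma reps_transform A B x :
  reps A B x = reps (A :|: B) (A :&: B) x + reps (A :\: B) (B :\: A) x.
Proof.
have dA : [disjoint A :&: B & A :\: B].
  by apply/pred0P => y /=; rewrite !inE; case: (y \in B); rewrite ?andbF.
have dB : [disjoint A :&: B & B :\: A].
  by apply/pred0P => y /=; rewrite !inE; case: (y \in A); rewrite ?andbF.
have dU : [disjoint A & B :\: A].
  by apply/pred0P => y /=; rewrite !inE; case: (y \in A).
have -> : A :|: B = A :|: (B :\: A).
  by apply/setP => y; rewrite !inE; case: (y \in A).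
rewrite (repsUl _ _ dU).
rewrite -{1}(setID B A) [B :&: A]setIC repsUr //.
rewrite -addnA; congr addn; rewrite -{1}(setID A B) repsUl //.
by rewrite [reps (A :&: B) _ _]repsC.
Qed.

Lemma reps_translate A B g x : reps A [set (g + b)%R | b in B] (g + x)%R = reps A B x.
Proof.
apply: eq_bigr => y _; congr (_ * nat_of_bool _)%N.
rewrite -addrA mem_imset //; exact: addrI.
Qed.

(** Pollard's theorem with an error term for subgroups: sums are counted with
    multiplicity truncated at q, and h bounds the order of the proper
    subgroups. By induction on |B|. If some translate B' of B meets A without
    being contained in it, pass to (A u B', A n B'), together with (A - B', B'
    - A) when A n B' has fewer than q elements. Otherwise B lies in a coset of
    the stabilizer of A, and every sum then has |B| representations. *)
Lemma pollard h q A B :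
  (forall H : {set G}, zmod_closed H -> H != setT -> #|H| <= h) ->
  q <= #|A| -> q <= #|B| -> #|A| + #|B| <= #|G| + q ->
  q * (#|A| + #|B|) <= \sum_x minn (reps A B x) q + q * (q + h).
Proof.
move=> hH; have [k] := ubnP #|B|; elim: k A B q => // k IH A B q; rewrite ltnS => leBk.
move=> qA qB AB.
have [eqB|neB] := eqVneq #|B| q.
  have -> : \sum_x minn (reps A B x) q = \sum_x reps A B x.
    by apply: eq_bigr => x _; apply/minn_idPl; rewrite -eqB reps_leq.
  by rewrite sum_reps eqB; nia.
have ltqB : q < #|B| by lia.
have [-> //|q_gt0] := posnP q.
have [/existsP[g /andP[I0 IB]]|nog] :=
  boolP [exists g : G, (0 < #|A :&: [set (g + b)%R | b in B]| < #|B|)].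
  pose B' : {set G} := [set (g + b)%R | b in B]; rewrite -[imset _ _]/B' in I0 IB.
  have cB : #|B'| = #|B| by rewrite card_imset //; exact: addrI.
  have -> : \sum_x minn (reps A B x) q = \sum_x minn (reps A B' x) q.
    rewrite [RHS](reindex_inj (addrI g)) /=.
    by apply: eq_bigr => x _; rewrite reps_translate.
  have cU : #|A :|: B'| + #|A :&: B'| = #|A| + #|B'| by exact: cardsUI.
  have cDA : #|A :&: B'| + #|A :\: B'| = #|A| by rewrite cardsID.
  have cDB : #|A :&: B'| + #|B' :\: A| = #|B'| by rewrite setIC cardsID.
  have cUG : #|A :|: B'| <= #|G| by apply: max_card.
  have [qI|Iq] := leqP q #|A :&: B'|.
    have := IH (A :|: B') (A :&: B') q.
    have -> : #|A :|: B'| + #|A :&: B'| = #|A| + #|B| by lia.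
    move=> /(_ ltac:(lia) ltac:(lia) ltac:(lia) ltac:(lia)) /leq_trans; apply.
    rewrite leq_add2r leq_sum // => x _; rewrite (reps_transform A B'); lia.
  have H1 := IH (A :|: B') (A :&: B') #|A :&: B'| ltac:(lia) ltac:(lia) ltac:(lia) ltac:(lia).
  have H2 := IH (A :\: B') (B' :\: A) (q - #|A :&: B'|) ltac:(lia) ltac:(lia) ltac:(lia) ltac:(lia).
  have H3 : \sum_x minn (reps (A :|: B') (A :&: B') x) #|A :&: B'|
          + \sum_x minn (reps (A :\: B') (B' :\: A) x) (q - #|A :&: B'|)
        <= \sum_x minn (reps A B' x) q.
    rewrite -big_split /= leq_sum // => x _; rewrite (reps_transform A B').
    by move: (reps _ _ x) (reps _ _ x) (#|A :&: B'|) Iq => r1 r2 i; lia.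
  move: H3 H1 H2; move: (\sum_x minn (reps A B' x) q) => s3.
  move: (\sum_x _) (\sum_x _) => s1 s2.
  have [j ej] : exists j, q = #|A :&: B'| + j by exists (q - #|A :&: B'|); lia.
  rewrite ej addKn; move: cU cDA cDB; rewrite cB.
  move: (#|A :|: B'|) (#|A :\: B'|) (#|B' :\: A|) (#|A :&: B'|) #|A| #|B|.
  by move=> u a' b' i a b eu ea eb H3 H1 H2; subst a b; nia.
(* From here on a translate of B which meets A is contained in A. *)
have sub a b b' : a \in A -> b \in B -> b' \in B -> (a - b + b')%R \in A.
  move=> aA bB b'B; move: nog; rewrite negb_exists => /forallP/(_ (a - b)%R).
  set gB := [set _ | _ in B].
  have cB : #|gB| = #|B| by rewrite card_imset //; exact: addrI.
  have -> : 0 < #|A :&: gB|.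
    apply/card_gt0P; exists a; rewrite inE aA.
    by apply/imsetP; exists b => //; rewrite subrK.
  rewrite /= -leqNgt -cB => leI.
  have : (a - b + b')%R \in A :&: gB.
    have /eqP -> : A :&: gB == gB by rewrite eqEcard subsetIr.
    by apply/imsetP; exists b'.
  by rewrite inE => /andP[].
(* H is the stabilizer of A, and B - b0 is contained in it. *)
pose H := [set x | [forall a in A, (a + x)%R \in A]].
have HP x : reflect {in A, forall a, (a + x)%R \in A} (x \in H).
  by rewrite inE; apply: (iffP forall_inP).
have Hadd x y : x \in H -> y \in H -> (x + y)%R \in H.
  by move=> /HP hx /HP hy; apply/HP => a aA; rewrite addrA; apply/hy/hx.
have H0 : 0%R \in H by apply/HP => a; rewrite addr0.
have Hopp x : x \in H -> (- x)%R \in H.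
  move=> xH; have imA : [set (a + x)%R | a in A] = A.
    apply/eqP; rewrite eqEcard card_imset ?leqnn ?andbT; last exact: addIr.
    by apply/subsetP => _ /imsetP[a aA ->]; apply: (HP _ xH).
  by apply/HP => a; rewrite -{1}imA => /imsetP[a' a'A ->]; rewrite addrK.
have zH : zmod_closed H by split=> // x y xH yH; apply/Hadd/Hopp.
have [b0 b0B] : exists b, b \in B by apply/card_gt0P; lia.
have leBH : #|B| <= #|H|.
  rewrite -(card_imset _ (addIr (- b0)%R)) subset_leq_card //.
  apply/subsetP => _ /imsetP[b bB ->]; apply/HP => a aA.
  by rewrite addrCA addrC; apply: sub.
have [HT|neHT] := eqVneq H setT.
  have [a0 a0A] : exists a, a \in A by apply/card_gt0P; lia.
  have AT : A = setT.
    apply/setP => x; rewrite inE -(subrK a0 x) addrC.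
    by have /HP -> : (x - a0)%R \in H by rewrite HT inE.
  by move: AB; rewrite AT cardsT leq_add2l leqNgt ltqB.
have {}leBH := leq_trans leBH (hH _ zH neHT).
suff: q * #|A| <= \sum_x minn (reps A B x) q.
  by have := leq_mul (leqnn q) leBH; rewrite !mulnDr; lia.
rewrite -(card_imset _ (addIr b0)) mulnC -sum_nat_const [leqLHS]big_mkcond.
apply: leq_sum => x _; case: ifP => // /imsetP[a aA ->].
have leBr : #|B| <= reps A B (a + b0)%R.
  rewrite repsC /reps -sum1_card [leqLHS]big_mkcond leq_sum // => b _.
  case: ifP => // bB; suff -> : (a + b0 - b)%R \in A by [].
  by rewrite addrAC; apply: sub.
by rewrite leq_min leqnn (leq_trans qB leBr).
Qed.
End Pollard.

(** The numbers without a divisor strictly between 1 and K: the moduli n for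
    which Z/n has only subgroups of small order besides itself. *)
Definition rough (K n : nat) := forall d, d %| n -> 1 < d -> K <= d.

Lemma card_subgroup_rough K n (H : {set 'I_n.+1}) :
  rough K n.+1 -> zmod_closed H -> H != setT -> #|H| * K <= n.+1.
Proof.
move=> rK [zH0 zHB] neH.
have gH : group_set H.
  apply/group_setP; split=> [|x y xH yH]; first exact: zH0.
  have -> : (x * y)%g = (x - (0 - y))%R by rewrite sub0r opprK.
  by apply/zHB => //; apply/zHB.
pose Hg := Group gH.
have := Lagrange (subsetT Hg); rewrite cardsT card_ord => e.
rewrite -[leqRHS]e leq_mul2l; apply/orP; right; apply: rK.
  by rewrite -[X in _ %| X]e dvdn_mull.
rewrite indexg_gt1; apply: contra neH => /subsetP sT.
by apply/eqP/setP => x; have := sT x; rewrite !inE => ->.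
Qed.

Lemma exists_subset_card (T : finType) (B : {set T}) k : k <= #|B| ->
  exists2 B' : {set T}, B' \subset B & #|B'| = k.
Proof.
move=> leB; exists [set x in take k (enum B)].
  by apply/subsetP => x; rewrite inE => /mem_take; rewrite mem_enum.
rewrite cardsE (card_uniqP _) ?take_uniq ?enum_uniq // size_take -cardE.
by case: ltngtP leB.
Qed.

Section SumAvoid.
Variable G : finZmodType.

Lemma reps_sub (A B B' : {set G}) x : B' \subset B -> reps A B' x <= reps A B x.
Proof.
move=> sB; apply: leq_sum => y _; rewrite leq_mul2l; apply/orP; right.
by case: (_ \in B') / boolP => // /(subsetP sB) ->.
Qed.

(** The second alternative covers sets A and B that are together so large that
    nearly every element is a sum in at least q ways; then C is almost
    empty. *)
Lemma pollard_avoid g h q (A B C : {set G}) :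
  #|G| = g ->
  (forall H : {set G}, zmod_closed H -> H != setT -> #|H| <= h) ->
  q <= #|A| -> q <= #|B| ->
  q * (#|A| + #|B| + #|C|) <= q * (g + q + h) + \sum_(x in C) reps A B x
  \/ q * #|C| <= q * h + \sum_(x in C) reps A B x.
Proof.
move=> <- {g} hH qA qB; set P := \sum_(x in C) _.
have key (B' : {set G}) : B' \subset B -> \sum_x minn (reps A B' x) q + q * #|C| <= P + q * #|G|.
  move=> sB; rewrite (bigID (mem C)) /= -addnA; apply: leq_add.
    by apply: leq_sum => x _; apply: leq_trans (geq_minl _ _) (reps_sub _ _ sB).
  apply: (@leq_trans (\sum_(x | x \notin C) q + q * #|C|)).
    by rewrite leq_add2r; apply: leq_sum => x _; apply: geq_minr.
  by rewrite sum_nat_const -(cardC (mem C)) mulnC -mulnDr addnC.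
have [AB|AB] := leqP (#|A| + #|B|) (#|G| + q).
  left; have := pollard hH qA qB AB; have := key _ (subxx B).
  move: (\sum_x minn _ _) (#|A|) (#|B|) (#|C|) (#|G|) => s a b c g; rewrite !mulnDr; lia.
(* Shrink B until |A| + |B| = |G| + q, where the truncated count of all sums
   is nearly q |G|. *)
right; have leA : #|A| <= #|G| by apply: max_card.
have [B' sB' cB'] : exists2 B' : {set G}, B' \subset B & #|B'| = #|G| + q - #|A|.
  by apply: exists_subset_card; move: AB leA; lia.
have qB' : q <= #|B'| by rewrite cB'; move: leA; lia.
have AB' : #|A| + #|B'| = #|G| + q by rewrite cB'; move: leA; lia.
have := pollard hH qA qB'; rewrite AB' => /(_ (leqnn _)); have := key _ sB'.
move: (\sum_x minn _ _) (#|C|) (#|G|) => s c g; rewrite !mulnDr; lia.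
Qed.
End SumAvoid.

Local Open Scope ring_scope.

Section Cyclic.
Variable R : realFieldType.

Lemma floor_half (x : R) m : 1 <= x -> x < m%:R ->
  exists q : nat, [/\ (0 < q)%N, q%:R <= x & x <= 2%:R * q%:R].
Proof.
move=> x1 xm; have [m' hm' min] := ex_minnP (ex_intro (fun m : nat => x < m%:R) m xm).
have : (1 < m')%N by rewrite -(ltr_nat R); apply: le_lt_trans hm'.
case: m' hm' min => [|[|q]] //; rewrite -natr1 => hq min _.
exists q.+1; have q1 : 1 <= q.+1%:R :> R by rewrite ler1n.
split=> //; last by lra.
by rewrite leNgt; apply/negP => /min; rewrite ltnn.
Qed.

(** The quotient in the third error term is the proportion of pairs of A x B
    whose sum falls in C. The difference of the densities of B and C has to
    appear, because the inequality fails when one of the two sets is empty and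
    the others are large. *)
Lemma cyclic_sumset_inequality (K n : nat) (A B C : {set 'I_n.+1}) (th : R) :
  (0 < K)%N -> rough K n.+1 -> 0 < th -> 1 <= th * n.+1%:R ->
  th * n.+1%:R <= #|A|%:R ->
  #|A|%:R / n.+1%:R + #|B|%:R / n.+1%:R + #|C|%:R / n.+1%:R <=
  1 + 2%:R * th + 2%:R / K%:R
  + 4%:R * ((\sum_(x in C) reps A B x)%N%:R / n.+1%:R ^+ 2 / th)
  + `|#|B|%:R / n.+1%:R - #|C|%:R / n.+1%:R|.
Proof.
move=> K0 rK th0; set N : R := n.+1%:R => thn thA.
set P := (\sum_(x in C) _)%N; set eta := P%:R / N ^+ 2.
have N0 : 0 < N by rewrite ltr0n.
have Kp : 0 < K%:R :> R by rewrite ltr0n.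
have eta0 : 0 <= eta by rewrite divr_ge0 ?sqr_ge0 ?ler0n.
set u := _ / N; set v := _ / N; set v' := _ / N.
have u1 : u <= 1 by rewrite ler_pdivrMr // mul1r ler_nat; have := max_card A; rewrite card_ord.
have Ki : 0 <= 2%:R / K%:R :> R by rewrite divr_ge0 ?ler0n.
have ei : 0 <= eta / th by rewrite divr_ge0 // ltW.
have ab1 := ler_norm (v - v'); have ab2 := ler_norm (v' - v); rewrite distrC in ab2.
have [vth|thv] := ltP v th; first by lra.
pose h := (n.+1 %/ K)%N.
have hH (H : {set 'I_n.+1}) : zmod_closed H -> H != setT -> (#|H| <= h)%N.
  by move=> zH nH; rewrite leq_divRL // card_subgroup_rough.
have hN : h%:R <= N / K%:R by rewrite ler_pdivlMr // -natrM ler_nat leq_divM.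
have thA1 : th * N < #|A|.+1%:R by apply: le_lt_trans thA _; rewrite ltr_nat.
have [q [q0 qth thq]] := floor_half thn thA1.
have qA : (q <= #|A|)%N by rewrite -(ler_nat R); apply: le_trans qth thA.
have qB : (q <= #|B|)%N.
  by rewrite -(ler_nat R); apply: le_trans qth _; rewrite -ler_pdivlMr.
have qp : 0 < q%:R :> R by rewrite ltr0n.
(* The pairs with sum in C count for little once divided by the threshold q,
   which is about th n. *)
have EP : P%:R <= q%:R * N * (2%:R * (eta / th)).
  have -> : P%:R = eta * N ^+ 2 by rewrite /eta mulfVK // gt_eqF // exprn_gt0.
  rewrite expr2.
  have -> : q%:R * N * (2%:R * (eta / th)) = eta * N * (2%:R * q%:R / th) by ring.
  rewrite [eta * (N * N)]mulrA ler_wpM2l ?(mulr_ge0 eta0 (ltW N0)) //.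
  by rewrite ler_pdivlMr // mulrC.
have [] := pollard_avoid C (card_ord n.+1) hH qA qB; rewrite -/P.
  rewrite -(ler_nat R) !natrD !natrM !natrD => hP.
  have {}hP : #|A|%:R + #|B|%:R + #|C|%:R <= N * (1 + th + K%:R^-1 + 2%:R * (eta / th)).
    rewrite -(ler_pM2l qp); apply: le_trans hP _.
    have := ler_wpM2l (ltW qp) hN; have := ler_wpM2l (ltW qp) qth.
    rewrite -/N; lra.
  have : u + v + v' <= 1 + th + K%:R^-1 + 2%:R * (eta / th).
    by rewrite /u /v /v' -!mulrDl ler_pdivrMr // mulrC.
  lra.
rewrite -(ler_nat R) !natrD !natrM => hP.
have {}hP : #|C|%:R <= N * (K%:R^-1 + 2%:R * (eta / th)).
  rewrite -(ler_pM2l qp); apply: le_trans hP _.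
  have := ler_wpM2l (ltW qp) hN; rewrite -/N; lra.
have : v' <= K%:R^-1 + 2%:R * (eta / th) by rewrite /v' ler_pdivrMr // mulrC.
lra.
Qed.
End Cyclic.

(** * Averages over finite types *)

Section Mean.
Variable R : realFieldType.

Definition mean (I : finType) (F : I -> R) : R := (\sum_i F i) / #|I|%:R.

Implicit Types I J : finType.

Lemma eq_mean I (F F' : I -> R) : F =1 F' -> mean F = mean F'.
Proof. by move=> eF; rewrite /mean (eq_bigr _ (fun i _ => eF i)). Qed.

Lemma meanD I (F F' : I -> R) : mean (fun i => F i + F' i) = mean F + mean F'.
Proof. by rewrite /mean big_split mulrDl. Qed.

Lemma meanZ I c (F : I -> R) : mean (fun i => c * F i) = c * mean F.
Proof. by rewrite /mean -mulr_sumr mulrA. Qed.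

Lemma meanB I (F F' : I -> R) : mean (fun i => F i - F' i) = mean F - mean F'.
Proof. by rewrite /mean sumrB mulrBl. Qed.

Lemma mean_cst I (c : R) : (0 < #|I|)%N -> mean (fun _ : I => c) = c.
Proof.
move=> I0; rewrite /mean sumr_const -[c *+ _]mulr_natr mulfK //.
by rewrite pnatr_eq0 -lt0n.
Qed.

Lemma le_mean I (F F' : I -> R) : (forall i, F i <= F' i) -> mean F <= mean F'.
Proof. by move=> leF; rewrite ler_wpM2r ?invr_ge0 ?ler0n ?ler_sum. Qed.

Lemma mean_ge0 I (F : I -> R) : (forall i, 0 <= F i) -> 0 <= mean F.
Proof. by move=> F0; rewrite mulr_ge0 ?sumr_ge0 ?invr_ge0 ?ler0n. Qed.

Lemma mean_le_cst I (F : I -> R) c : 0 <= c -> (forall i, F i <= c) -> mean F <= c.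
Proof.
move=> c0 leF; have [I0|] := posnP #|I|; first by rewrite /mean I0 invr0 mulr0.
by move=> I0; rewrite -[leRHS](mean_cst c I0) le_mean.
Qed.

Lemma exchange_mean I J (F : I -> J -> R) :
  mean (fun i => mean (F i)) = mean (fun j => mean (F^~ j)).
Proof.
rewrite /mean -!mulr_suml exchange_big /= -!mulrA; congr (_ * _).
by rewrite mulrC.
Qed.

Lemma mean_pair I J (F : I * J -> R) :
  mean F = mean (fun i => mean (fun j => F (i, j))).
Proof.
rewrite /mean -mulr_suml pair_big /= card_prod natrM invfM -mulrA [_^-1 * _]mulrC.
by congr (_ * _); apply: eq_bigr => -[].
Qed.

Lemma mean_bij I J (h : J -> I) (F : I -> R) :
  bijective h -> mean F = mean (fun j => F (h j)).
Proof.
move=> bh; rewrite /mean (reindex h) /=; last exact: onW_bij.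
by rewrite (bij_eq_card bh).
Qed.

Lemma mean_sqr_le I (F : I -> R) : (mean F) ^+ 2 <= mean (fun i => F i ^+ 2).
Proof.
have [I0|I0] := posnP #|I|.
  by rewrite /mean I0 invr0 !mulr0 expr0n.
have : 0 <= mean (fun i => (F i - mean F) ^+ 2) by apply: mean_ge0 => i; apply: sqr_ge0.
rewrite (@eq_mean _ _ (fun i => F i ^+ 2 + ((- (2%:R * mean F)) * F i + mean F ^+ 2))).
  rewrite meanD meanD meanZ mean_cst //; nra.
by move=> i /=; ring.
Qed.

Lemma norm_mean I (F : I -> R) : `|mean F| <= mean (fun i => `|F i|).
Proof.
by rewrite /mean normrM [X in _ * X <= _]ger0_norm ?invr_ge0 ?ler0n // ler_wpM2r ?invr_ge0 ?ler0n ?ler_norm_sum.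
Qed.

Lemma mean_abs_le I (F : I -> R) c : 0 <= c ->
  mean (fun i => F i ^+ 2) <= c ^+ 2 -> mean (fun i => `|F i|) <= c.
Proof.
move=> c0 h; rewrite -(ler_pXn2r (n := 2)) ?nnegrE ?mean_ge0 //.
apply: le_trans h; apply: le_trans (mean_sqr_le _) _.
by apply: le_mean => i; rewrite -normrX ger0_norm ?sqr_ge0.
Qed.

Lemma exists_le_mean I (F : I -> R) : (0 < #|I|)%N -> exists i, F i <= mean F.
Proof.
move=> I0; apply/existsP; apply: contraT; rewrite negb_exists => /forallP hF.
have /card_gt0P[i0 _] := I0.
have : \sum_(i : I) mean F < \sum_(i : I) F i.
  apply: ltr_sum => [|i _]; last by rewrite ltNge hF.
  by apply/hasP; exists i0; rewrite ?mem_index_enum.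
rewrite sumr_const -[_ *+ _]mulr_natr mulfVK ?ltxx //.
by rewrite pnatr_eq0 -lt0n.
Qed.

Lemma mean_ord n (F : nat -> R) : mean (fun i : 'I_n => F i) = (\sum_(i < n) F i) / n%:R.
Proof. by rewrite /mean card_ord. Qed.

Lemma sum_ord_mul a b (F : nat -> R) :
  \sum_(k < a * b) F k = \sum_(i < a) \sum_(j < b) F (i + a * j)%N.
Proof.
rewrite exchange_big /=; elim: b => [|b IH]; first by rewrite muln0 !big_ord0.
rewrite big_ord_recr /= -IH mulnSr big_split_ord /=; congr (_ + _).
by apply: eq_bigr => i _; rewrite addnC.
Qed.

Lemma mean_ord_mul a b (F : nat -> R) :
  mean (fun k : 'I_(a * b) => F k) =
  mean (fun i : 'I_a => mean (fun j : 'I_b => F (i + a * j)%N)).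
Proof.
rewrite mean_ord sum_ord_mul.
rewrite (mean_ord a (fun i => mean (fun j : 'I_b => F (i + a * j)%N))).
under [in RHS]eq_bigr => i _ do rewrite (mean_ord b (fun j => F (i + a * j)%N)).
by rewrite -mulr_suml natrM invfM -mulrA [a%:R^-1 * _]mulrC.
Qed.

End Mean.

(** * Averages of stationary sequences over progressions *)

Section Stationary.
Variables (R : realFieldType) (D : finType).
Hypothesis D0 : (0 < #|D|)%N.
Implicit Types (u v w : D -> R) (X : nat -> D -> R).

Definition dot u v : R := mean (fun d => u d * v d).
Definition sqnorm u : R := dot u u.

Lemma sqnorm_ge0 u : 0 <= sqnorm u.
Proof. by apply: mean_ge0 => d; rewrite -expr2 sqr_ge0. Qed.

Definition block X (s m n : nat) : D -> R :=
  fun d => mean (fun i : 'I_n => X (s + m * i)%N d).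

Lemma dot_mean (I J : finType) (F : I -> D -> R) (F' : J -> D -> R) :
  dot (fun d => mean (fun i => F i d)) (fun d => mean (fun j => F' j d)) =
  mean (fun i => mean (fun j => dot (F i) (F' j))).
Proof.
rewrite /dot; under [RHS]eq_mean => i do rewrite exchange_mean.
rewrite [RHS]exchange_mean; apply: eq_mean => d.
rewrite mulrC -meanZ; apply: eq_mean => i.
by rewrite mulrC -meanZ.
Qed.

Lemma sqnormB u v : sqnorm (fun d => u d - v d) = sqnorm u - 2%:R * dot u v + sqnorm v.
Proof.
rewrite /sqnorm /dot -meanZ -meanB -meanD; apply: eq_mean => d /=; ring.
Qed.

Lemma sqnormB_le u v w :
  sqnorm (fun d => u d - w d) <=
  2%:R * sqnorm (fun d => u d - v d) + 2%:R * sqnorm (fun d => v d - w d).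
Proof.
rewrite /sqnorm /dot -!meanZ -meanD; apply: le_mean => d /=.
rewrite -subr_ge0; set z := (X in 0 <= X).
have -> : z = (u d - v d - (v d - w d)) ^+ 2 by rewrite /z; ring.
exact: sqr_ge0.
Qed.

Lemma sqnorm_sup u c : (forall d, `|u d| <= c) -> sqnorm u <= c ^+ 2.
Proof.
move=> uc; have c0 : 0 <= c.
  by have /card_gt0P[d _] := D0; apply: le_trans (uc d).
apply: mean_le_cst; first exact: sqr_ge0.
by move=> d; rewrite -expr2 -[_ ^+ 2]ger0_norm ?sqr_ge0 // normrX ler_pXn2r ?nnegrE.
Qed.

Variable X : nat -> D -> R.
Hypothesis stat : forall i j k, dot (X (i + k)) (X (j + k)) = dot (X i) (X j).

Lemma sqnorm_block s m n : sqnorm (block X s m n) = sqnorm (block X 0 m n).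
Proof.
rewrite /sqnorm /block !dot_mean; apply: eq_mean => i; apply: eq_mean => j.
by rewrite !(addnC s) stat !add0n.
Qed.

Lemma block_tile s m q l J d :
  block X s m (q * (l * J)) d =
  mean (fun r : 'I_q => mean (fun j : 'I_J =>
    block X (s + m * (r + q * (l * j))) (m * q) l d)).
Proof.
rewrite /block (mean_ord_mul q (l * J) (fun k => X (s + m * k)%N d)); apply: eq_mean => r.
rewrite (mean_ord_mul l J (fun k => X (s + m * (r + q * k)) d)) exchange_mean.
apply: eq_mean => j; apply: eq_mean => i; congr X; lia.
Qed.

(** A long block of step m is the average of its tiles, which are shorter
    blocks of step m q, and all tiles have the same norm by stationarity. So
    the variance of the tiles is the difference of the two energies. *)
Lemma tile_gap m q l J : (0 < q)%N -> (0 < J)%N ->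
  mean (fun r : 'I_q => mean (fun j : 'I_J =>
    sqnorm (fun d => block X 0 m (q * (l * J)) d
                     - block X (m * (r + q * (l * j))) (m * q) l d))) =
  sqnorm (block X 0 (m * q) l) - sqnorm (block X 0 m (q * (l * J))).
Proof.
move=> q0 J0; set C := block X 0 m _.
under eq_mean => r do under eq_mean => j do
  rewrite sqnormB sqnorm_block.
under eq_mean => r do rewrite meanD meanB meanZ !mean_cst ?card_ord //.
rewrite meanD meanB meanZ !mean_cst ?card_ord //.
have -> : mean (fun r : 'I_q => mean (fun j : 'I_J =>
    dot C (block X (m * (r + q * (l * j))) (m * q) l))) = sqnorm C.
  rewrite /sqnorm /dot; under eq_mean => r do rewrite exchange_mean.
  rewrite exchange_mean; apply: eq_mean => d.
  under eq_mean => r do rewrite meanZ.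
  by rewrite meanZ /C block_tile.
ring.
Qed.

Lemma sqnorm_blk_le m q l J : (0 < q)%N -> (0 < J)%N ->
  sqnorm (block X 0 m (q * (l * J))) <= sqnorm (block X 0 (m * q) l).
Proof.
move=> q0 J0; rewrite -subr_ge0 -tile_gap //.
by apply: mean_ge0 => r; apply: mean_ge0 => j; apply: sqnorm_ge0.
Qed.

Hypothesis X1 : forall k d, `|X k d| <= 1.

Lemma block_sup s m n d : `|block X s m n d| <= 1.
Proof.
apply: le_trans (norm_mean _) _; apply: mean_le_cst => // i; exact: X1.
Qed.

Lemma block_sub s m n i n' d : (0 < n')%N -> (i + n' <= n)%N ->
  `|block X s m n d - block X (s + m * i) m n' d| <= 2%:R * (n - n')%:R / n%:R.
Proof.
move=> n'0 le_n; pose f k := X (s + m * k)%N d.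
have n0 : (0 < n)%N by lia.
have -> : block X (s + m * i) m n' d = (\sum_(i <= k < i + n') f k) / n'%:R.
  rewrite /block (mean_ord n' (fun k => X (s + m * i + m * k)%N d)); congr (_ / _).
  rewrite -[in RHS](add0n i) big_addn add0n addKn big_mkord; apply: eq_bigr => k _.
  by rewrite /f; congr X; lia.
have -> : block X s m n d = (\sum_(0 <= k < n) f k) / n%:R.
  by rewrite /block (mean_ord n f) big_mkord.
rewrite (@big_cat_nat _ _ _ i) //=; last by lia.
rewrite (@big_cat_nat _ _ _ (i + n') i n) //=; last by lia.
set a := \sum_(0 <= _ < i) _; set b := \sum_(i <= _ < _) _; set c := \sum_(_ <= _ < n) _.
have sumle p p' : (p <= p')%N -> `|\sum_(p <= k < p') f k| <= (p' - p)%:R.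
  move=> lep; apply: le_trans (ler_norm_sum _ _ _) _.
  rewrite -[X in _ <= X]mul1r mulr_natr -sumr_const_nat.
  by apply: ler_sum => k _; apply: X1.
have ha : `|a| <= i%:R by rewrite /a -[X in _ <= X%:R](subn0 i) sumle.
have hc : `|c| <= (n - (i + n'))%:R by apply: sumle.
have hb : `|b| <= n'%:R.
  by apply: le_trans (sumle _ _ _) _; rewrite ?leq_addr // addKn.
have En : n%:R = n'%:R + i%:R + (n - (i + n'))%:R :> R.
  by rewrite -!natrD; congr _%:R; lia.
have -> : (n - n')%:R = i%:R + (n - (i + n'))%:R :> R.
  by rewrite -natrD; congr _%:R; lia.
have npos : 0 < n%:R :> R by rewrite ltr0n.
have n'pos : 0 < n'%:R :> R by rewrite ltr0n.
rewrite En in npos *; move: (n - _)%:R (i%:R) (n'%:R) ha hb hc npos n'pos => {En} z x y.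
move=> ha hb hc npos n'pos.
have -> : (a + (b + c)) / (y + x + z) - b / y = (a + c - (x + z) * (b / y)) / (y + x + z).
  by field; rewrite !gt_eqF.
rewrite normrM [ `|_^-1|]ger0_norm ?invr_ge0 ?(ltW npos) // ler_wpM2r ?invr_ge0 ?(ltW npos) //.
have hby : `|b / y| <= 1.
  by rewrite normrM [ `|_^-1|]ger0_norm ?invr_ge0 ?(ltW n'pos) // ler_pdivrMr // mul1r.
apply: le_trans (ler_normB _ _) _; apply: le_trans (lerD (ler_normD _ _) (lexx _)) _.
have xz0 : 0 <= x + z by apply: addr_ge0; [apply: le_trans ha|apply: le_trans hc].
rewrite normrM (ger0_norm xz0); nra.
Qed.

Lemma sqnorm_mean (I : finType) (F : I -> D -> R) :
  sqnorm (fun d => mean (fun i => F i d)) <= mean (fun i => sqnorm (F i)).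
Proof.
rewrite /sqnorm /dot exchange_mean; apply: le_mean => d.
by rewrite -expr2; apply: le_trans (mean_sqr_le _) _; apply: le_mean.
Qed.

Lemma sum_subgrid q0 q1 j0 Jb J (a : nat -> nat -> R) :
  (forall r j, 0 <= a r j) -> (0 < q0)%N -> (j0 + Jb <= J)%N ->
  \sum_(r < q1) \sum_(j < Jb) a (q0 * r)%N (j0 + j)%N <=
  \sum_(r < q0 * q1) \sum_(j < J) a r j.
Proof.
move=> a0; case: q0 => // q0 _ /subnKC <-.
rewrite (sum_ord_mul q0.+1 q1 (fun r => \sum_(j < j0 + Jb + (J - (j0 + Jb))) a r j)).
rewrite big_ord_recl /= -[leLHS]addr0 lerD //; last first.
  by apply: sumr_ge0 => i _; apply: sumr_ge0 => r _; apply: sumr_ge0 => j _.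
apply: ler_sum => r _; rewrite !big_split_ord /= add0n.
rewrite -[leLHS]addr0 lerD //; last by apply: sumr_ge0.
by rewrite -[leLHS]add0r lerD //; apply: sumr_ge0.
Qed.

(** A block of step m0 q0 is, up to its two ends, a union of tiles of step m0
    q0 q1. These are a fraction about n / (q0 q1 l J) of all the tiles of the
    coarse block, so their mean square distance to the coarse block is at most
    the variance of all tiles divided by that fraction. The last term of the
    bound accounts for the ends. *)
Lemma block_close m0 q0 q1 l J i n :
  (0 < q0)%N -> (0 < q1)%N -> (0 < l)%N ->
  (4 * (q1 * l) <= n)%N -> (i + n <= q1 * l * J)%N ->
  sqnorm (fun d => block X 0 m0 (q0 * q1 * (l * J)) d - block X (m0 * q0 * i) (m0 * q0) n d) <=
  4%:R * (q0%:R * (q1 * l * J)%:R / n%:R) *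
    (sqnorm (block X 0 (m0 * (q0 * q1)) l) - sqnorm (block X 0 m0 (q0 * q1 * (l * J))))
  + 32%:R * ((q1 * l)%:R / n%:R) ^+ 2.
Proof.
move=> q00 q10 l0; set T := (q1 * l)%N => hn hi.
have T0 : (0 < T)%N by rewrite muln_gt0 q10.
(* The tiles contained in [i, i + n) are those with index j0 <= j < j0 +
   Jb. *)
pose j0 := ((i + T.-1) %/ T)%N; pose Jb := ((i + n) %/ T - j0)%N.
have hj0 : (i <= j0 * T < i + T)%N.
  by rewrite /j0; have := divn_eq (i + T.-1) T; have := ltn_pmod (i + T.-1) T0; nia.
have hj1 : ((i + n) %/ T * T <= i + n < (i + n) %/ T * T + T)%N.
  by have := divn_eq (i + n) T; have := ltn_pmod (i + n) T0; nia.
have Jb0 : (j0 < (i + n) %/ T)%N by rewrite ltnNge; apply/negP; nia.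
have hJbJ : (j0 + Jb <= J)%N.
  rewrite subnKC; last by lia.
  by rewrite -(leq_pmul2r T0); nia.
have hTJb : (n <= Jb * T + 2 * T)%N by rewrite mulnBl; nia.
have hTJb' : (j0 * T + Jb * T <= i + n)%N by rewrite -mulnDl subnKC; lia.
have J0 : (0 < J)%N by lia.
have Jbp : (0 < Jb)%N by rewrite subn_gt0.
pose m := (m0 * q0)%N.
pose C := block X 0 m0 (q0 * q1 * (l * J)).
pose B := block X (m * i) m n.
pose B' := block X (m * (j0 * T)) m (q1 * (l * Jb)).
rewrite -/m -/C -/B.
pose a r j := sqnorm (fun d => C d - block X (m0 * (r + q0 * q1 * (l * j))) (m0 * (q0 * q1)) l d).
set gap := sqnorm _ - _.
have Egap : \sum_(r < q0 * q1) \sum_(j < J) a r j = (q0 * q1)%:R * J%:R * gap.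
  rewrite /gap -tile_gap ?muln_gt0 ?q00 //.
  under [in RHS]eq_mean => r do rewrite (mean_ord J (a r)).
  rewrite (mean_ord (q0 * q1) (fun r => (\sum_(j < J) a r j) / J%:R)) -mulr_suml.
  by field; rewrite !pnatr_eq0 -!lt0n J0 q00 q10.
have gap0 : 0 <= gap.
  by rewrite subr_ge0 sqnorm_blk_le ?muln_gt0 ?q00.
have CB' : sqnorm (fun d => C d - B' d) <= q0%:R * J%:R / Jb%:R * gap.
  have := @sum_subgrid q0 q1 j0 Jb J a (fun _ _ => sqnorm_ge0 _) q00 hJbJ.
  rewrite Egap => hsum.
  have : sqnorm (fun d => C d - B' d) <=
      mean (fun r : 'I_q1 => mean (fun j : 'I_Jb => a (q0 * r)%N (j0 + j)%N)).
    pose F (r : 'I_q1) (j : 'I_Jb) d :=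
      C d - block X (m * (j0 * T) + m * (r + q1 * (l * j))) (m * q1) l d.
    rewrite (_ : sqnorm _ = sqnorm (fun d => mean (fun r => mean (fun j => F r j d)))).
      apply: le_trans (sqnorm_mean _) _; apply: le_mean => r.
      apply: le_trans (sqnorm_mean _) _; apply: le_mean => j.
      rewrite le_eqVlt; apply/orP; left; apply/eqP.
      rewrite /a /sqnorm /dot; apply: eq_mean => d; rewrite /F.
      have -> : (m * (j0 * T) + m * (r + q1 * (l * j)) =
        m0 * (q0 * r + q0 * q1 * (l * (j0 + j))))%N by rewrite /m /T; nia.
      by have -> : (m * q1 = m0 * (q0 * q1))%N by rewrite /m mulnA.
    rewrite /sqnorm /dot; apply: eq_mean => d.
    rewrite (_ : mean _ = C d - B' d) // /F.
    under eq_mean => r do rewrite meanB mean_cst ?card_ord //.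
    by rewrite meanB mean_cst ?card_ord // /B' block_tile.
  move/le_trans; apply.
  under eq_mean => r do rewrite (mean_ord Jb (fun j => a (q0 * r)%N (j0 + j)%N)).
  rewrite (mean_ord q1 (fun r => (\sum_(j < Jb) a (q0 * r)%N (j0 + j)%N) / Jb%:R)) -mulr_suml.
  have q1p : 0 < q1%:R :> R by rewrite ltr0n.
  have Jp : 0 < Jb%:R :> R by rewrite ltr0n.
  rewrite ler_pdivrMr // ler_pdivrMr //; apply: le_trans hsum _.
  rewrite natrM le_eqVlt; apply/orP; left; apply/eqP; field.
  by rewrite gt_eqF.
have BB' : sqnorm (fun d => B' d - B d) <= (4%:R * (T%:R / n%:R)) ^+ 2.
  apply: sqnorm_sup => d; rewrite distrC.
  have -> : B' = block X (m * i + m * (j0 * T - i)) m (Jb * T).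
    rewrite /B'; congr (block _ _ _ _); last by rewrite /T; nia.
    by rewrite -mulnDr subnKC; lia.
  apply: le_trans (block_sub _ _ _ _ _) _; [by rewrite muln_gt0 Jbp|by lia|].
  rewrite mulrA ler_wpM2r ?invr_ge0 ?ler0n //.
  by rewrite -!natrM ler_nat; nia.
apply: le_trans (sqnormB_le _ B' _) _; apply: lerD.
  apply: (@le_trans _ _ (2%:R * (q0%:R * J%:R / Jb%:R * gap))).
    by rewrite ler_wpM2l.
  rewrite mulrA ler_wpM2r // natrM.
  have Jp : 0 < Jb%:R :> R by rewrite ltr0n.
  have np : 0 < n%:R :> R by rewrite ltr0n; lia.
  have : n%:R <= 2%:R * (Jb%:R * T%:R) :> R by rewrite -!natrM ler_nat; nia.
  move=> hh; have x0 : 0 <= q0%:R * J%:R :> R by rewrite mulr_ge0 ?ler0n.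
  have {}hh := ler_wpM2l x0 hh.
  suff : q0%:R * J%:R / Jb%:R <= 2%:R * (q0%:R * (T%:R * J%:R) / n%:R) :> R by lra.
  rewrite ler_pdivrMr //.
  have -> : 2%:R * (q0%:R * (T%:R * J%:R) / n%:R) * Jb%:R =
            (q0%:R * J%:R * (2%:R * (Jb%:R * T%:R))) / n%:R :> R by ring.
  by rewrite ler_pdivlMr.
apply: (@le_trans _ _ (2%:R * (4%:R * (T%:R / n%:R)) ^+ 2)); first by rewrite ler_wpM2l.
by rewrite exprMn; lra.
Qed.
End Stationary.

(** * Sampling and recurrence *)

Section Sampling.
Variable R : realFieldType.

(** A greedy choice, with no probability: the cross term between the current
    error and the error added by a new point has mean 0 over that point, so
    some point makes the sum of squares grow by at most 1. *)
Lemma sampling (I D : finType) (Y : I -> D -> R) (M : nat) :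
  (0 < #|I|)%N -> (forall i d, 0 <= Y i d <= 1) ->
  exists2 xs : seq I, size xs = M &
    mean (fun d => (\sum_(x <- xs) (Y x d - mean (Y^~ d))) ^+ 2) <= M%:R.
Proof.
move=> I0 Y01; pose F d := mean (Y^~ d).
have F01 d : 0 <= F d <= 1.
  rewrite mean_ge0 => [|i]; last by case/andP: (Y01 i d).
  by apply: mean_le_cst => // i; case/andP: (Y01 i d).
elim: M => [|M [xs sz_xs IH]].
  exists [::] => //; apply: mean_le_cst => // d.
  by rewrite big_nil expr0n.
pose s d := \sum_(x <- xs) (Y x d - F d).
have [x hx] := exists_le_mean (fun x => mean (fun d => (Y x d - F d + s d) ^+ 2)) I0.
exists (x :: xs); first by rewrite /= sz_xs.
under eq_mean => d do rewrite big_cons.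
apply: (le_trans hx); rewrite exchange_mean.
have -> : mean (fun d => mean (fun x => (Y x d - F d + s d) ^+ 2)) =
  mean (fun d => mean (fun x => (Y x d - F d) ^+ 2)) + mean (fun d => s d ^+ 2).
  rewrite -meanD; apply: eq_mean => d.
  rewrite (@eq_mean _ _ _ (fun x => (Y x d - F d) ^+ 2 +
     ((2%:R * s d) * (Y x d - F d) + s d ^+ 2))); last by move=> y; ring.
  rewrite meanD meanD meanZ meanB !mean_cst // /F subrr mulr0 add0r //.
rewrite -natr1 addrC; apply: lerD => //.
apply: mean_le_cst => // d; apply: mean_le_cst => // y.
have := Y01 y d; have := F01 d; nra.
Qed.

(** Among the indices without a later partner the pattern is injective. *)
Lemma card_no_partner n (T : finType) (good : pred 'I_n) (pat : 'I_n -> T) :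
  (#|[set a : 'I_n | good a &
       ~~ [exists b : 'I_n, [&& (a < b)%N, good b & pat a == pat b]]]| <= #|T|)%N.
Proof.
rewrite -(card_in_imset (f := pat)); first exact: max_card.
move=> a b; rewrite !inE => /andP[ga /existsPn na] /andP[gb /existsPn nb] eab.
apply/val_inj/eqP; rewrite eqn_leq; apply/andP; split; rewrite leqNgt; apply/negP => lt.
  by have := nb a; rewrite lt ga eab eqxx.
by have := na b; rewrite lt gb eab eqxx.
Qed.

Lemma card_markov (I : finType) (F : I -> R) (c : R) : 0 < c ->
  (forall i, 0 <= F i) -> #|[set i | c < F i]|%:R * c <= \sum_i F i.
Proof.
move=> c0 F0; rewrite mulr_natl -sumr_const big_mkcond /=; apply: ler_sum => i _.
by rewrite inE; case: ifP => // /ltW.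
Qed.
End Sampling.

Section Recurrence.
Variables (R : realFieldType) (G : finZmodType) (V : pred G).

Definition ind (x : G) : R := (V x)%:R.
Definition corr (h : G) : R := mean (fun x => ind x * ind (x + h)).

Lemma ind01 x : 0 <= ind x <= 1.
Proof. by rewrite /ind; case: (V x); rewrite ?lexx ler01. Qed.

Lemma cardG : (0 < #|G|)%N.
Proof. by apply/card_gt0P; exists 0. Qed.

Lemma mean_ind_corr z t : mean (fun x => ind (x + z) * ind (x + t)) = corr (t - z).
Proof.
rewrite /corr (mean_bij (fun x => ind x * ind (x + (t - z))) (h := fun x => x + z)).
  by apply: eq_mean => x; rewrite -addrA addrC [z + _]addrC subrK addrC.
by exists (fun x => x - z) => x; rewrite ?addrK ?subrK.
Qed.

(** Sampling M points x replaces corr (t - z b) by an average of products ind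
    (x + z b) * ind (x + t), which depends on b only through the M bits V (x +
    z b). Two indices with the same bits, for which the sample is accurate,
    have nearly equal functions; the two terms of the bound count the indices
    left alone by the pigeonhole principle and those for which the sample is
    bad. *)
Lemma few_nonrecurrent n k (z : 'I_n -> G) (t : 'I_k -> G) M (delta : R) :
  (0 < M)%N -> 0 < delta ->
  #|[set a : 'I_n | ~~ [exists b : 'I_n, (a < b)%N &&
       (mean (fun i => (corr (t i - z a) - corr (t i - z b)) ^+ 2) <= 4%:R * delta)]]|%:R
  <= (2 ^ M)%:R + n%:R / (M%:R * delta).
Proof.
move=> M0 delta0; set noP := [set a | _].
pose Y x (d : 'I_n * 'I_k) := ind (x + z d.1) * ind (x + t d.2).
have Y01 x d : 0 <= Y x d <= 1.
  by have := ind01 (x + z d.1); have := ind01 (x + t d.2); rewrite /Y; nra.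
have [xs szxs hxs] := sampling M cardG Y01.
pose s b i := \sum_(x <- xs) (ind (x + z b) * ind (x + t i) - corr (t i - z b)).
pose err b := mean (fun i => s b i ^+ 2).
have herr : mean err <= M%:R.
  apply: le_trans hxs; rewrite mean_pair le_eqVlt; apply/orP; left; apply/eqP.
  apply: eq_mean => b; apply: eq_mean => i; congr (_ ^+ 2).
  by apply: eq_bigr => x _; rewrite /Y /= mean_ind_corr.
have err0 b : 0 <= err b by apply: mean_ge0 => i; apply: sqr_ge0.
have Mp : 0 < M%:R :> R by rewrite ltr0n.
pose c := M%:R ^+ 2 * delta.
have c0 : 0 < c by rewrite mulr_gt0 ?exprn_gt0.
pose pat b : M.-tuple bool := tcast szxs (map_tuple (fun x => V (x + z b)) (in_tuple xs)).
have sub : noP \subset [set b | c < err b] :|: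
   [set a : 'I_n | err a <= c &
       ~~ [exists b : 'I_n, [&& (a < b)%N, err b <= c & pat a == pat b]]].
  apply/subsetP => a; rewrite !inE [_ < _]ltNge; case: (boolP (err a <= c)) => //= ga.
  apply: contra => /existsP[b /and3P[ltab gb /eqP eab]].
  apply/existsP; exists b; rewrite ltab /=.
  have {}eab x : x \in xs -> V (x + z a) = V (x + z b).
    have : map (fun x => V (x + z a)) xs = map (fun x => V (x + z b)) xs.
      by have := congr1 (@tval _ _) eab; rewrite !val_tcast.
    by move/eq_in_map => h /h.
  have Eab i : s a i - s b i = M%:R * (corr (t i - z b) - corr (t i - z a)).
    rewrite /s -sumrB big_seq (eq_bigr (fun _ => corr (t i - z b) - corr (t i - z a))).
      by rewrite -big_seq big_const_seq count_predT szxs iter_addr_0 mulr_natl.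
    by move=> x /eab e; rewrite /ind e; ring.
  have : M%:R ^+ 2 * mean (fun i => (corr (t i - z a) - corr (t i - z b)) ^+ 2) <= 4%:R * c.
    rewrite -meanZ; apply: (@le_trans _ _ (2%:R * err a + 2%:R * err b)); last by lra.
    rewrite -!meanZ -meanD; apply: le_mean => i.
    rewrite -exprMn -sqrrN -mulrN opprB -Eab.
    have := sqr_ge0 (s a i + s b i); nra.
  by rewrite /c [4%:R * _]mulrCA ler_pM2l ?exprn_gt0.
apply: (@le_trans _ _ (#|[set b | c < err b]| + 2 ^ M)%:R).
  rewrite ler_nat; apply: leq_trans (subset_leq_card sub) _.
  apply: leq_trans (leq_card_setU _ _) _; rewrite leq_add2l.
  by apply: leq_trans (card_no_partner _ _) _; rewrite card_tuple card_bool.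
rewrite natrD addrC lerD2l.
have := card_markov c0 err0 => h.
have [n0|n0] := posnP n.
  have /eqP -> : #|[set b | c < err b]| == 0%N.
    by rewrite -leqn0; apply: leq_trans (max_card _) _; rewrite card_ord n0.
  by rewrite mulr0n divr_ge0 ?ler0n ?mulr_ge0 ?ler0n ?(ltW delta0).
have np : 0 < n%:R :> R by rewrite ltr0n.
move: herr; rewrite /mean card_ord ler_pdivrMr // => herr.
have {}h := le_trans h herr.
rewrite ler_pdivlMr ?mulr_gt0 // -(ler_pM2l Mp).
move: h; rewrite /c; lra.
Qed.
End Recurrence.

(** * The inequality for one block *)

Section Shifts.
Variables (R : realFieldType) (G : finZmodType) (e : G) (V : pred G).
Local Notation ind := (ind R V).
Local Notation corr := (corr R V).

Definition shift1 (k : nat) (x : G) : R := ind (x + e *+ k).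
Definition shift2 (k : nat) (p : G * G) : R := shift1 k p.1 * shift1 k p.2.

Lemma mean_shift (F : G -> R) h : mean (fun x => F (x + h)) = mean F.
Proof.
rewrite [RHS](mean_bij F (h := fun x => x + h)) //.
by exists (fun x => x - h) => x; rewrite ?addrK ?subrK.
Qed.

Lemma shift1_stat i j k :
  dot (shift1 (i + k)) (shift1 (j + k)) = dot (shift1 i) (shift1 j).
Proof.
rewrite -[RHS](mean_shift _ (e *+ k)); apply: eq_mean => x.
by rewrite /shift1 !mulrnDr !addrA ![_ + _ + e *+ k]addrAC.
Qed.

Lemma shift2_stat i j k :
  dot (shift2 (i + k)) (shift2 (j + k)) = dot (shift2 i) (shift2 j).
Proof.
have dot2 a b : dot (shift2 a) (shift2 b) = dot (shift1 a) (shift1 b) ^+ 2.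
  rewrite /dot mean_pair expr2 -[in RHS]meanZ; apply: eq_mean => x.
  rewrite mulrC -meanZ; apply: eq_mean => y.
  by rewrite /shift2 /= mulrACA.
by rewrite !dot2 shift1_stat.
Qed.

Lemma shift1_le1 k x : `|shift1 k x| <= 1.
Proof. by have /andP[a b] := ind01 R V (x + e *+ k); rewrite /shift1 ger0_norm. Qed.

Lemma shift2_le1 k p : `|shift2 k p| <= 1.
Proof. by rewrite normrM mulr_ile1 ?shift1_le1. Qed.

(** corr (t - za) - corr (t - zb) is the inner product of the translate by t
    with a fixed function, so its square is linear in the tensor square of the
    translate. This is why blocks of [shift2] are needed. *)
Lemma corr_diff_block s m n za zb :
  mean (fun i : 'I_n => (corr (e *+ (s + m * i) - za) - corr (e *+ (s + m * i) - zb)) ^+ 2) =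
  mean (fun p : G * G => (ind (p.1 + za) - ind (p.1 + zb)) *
     (ind (p.2 + za) - ind (p.2 + zb)) * block shift2 s m n p).
Proof.
under eq_mean => i do rewrite -!mean_ind_corr -meanB expr2.
rewrite mean_pair.
under [RHS]eq_mean => x do under eq_mean => y do rewrite -meanZ.
under [RHS]eq_mean => x do rewrite exchange_mean.
rewrite [RHS]exchange_mean; apply: eq_mean => i.
rewrite -meanZ; apply: eq_mean => x; rewrite mulrC -meanZ; apply: eq_mean => y.
by rewrite /shift2 /shift1 /=; ring.
Qed.

Lemma corr_diff_close s m n s' m' n' za zb d : 0 <= d ->
  sqnorm (fun p => block shift2 s m n p - block shift2 s' m' n' p) <= d ^+ 2 ->
  mean (fun i : 'I_n' => (corr (e *+ (s' + m' * i) - za) - corr (e *+ (s' + m' * i) - zb)) ^+ 2) <=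
  mean (fun i : 'I_n => (corr (e *+ (s + m * i) - za) - corr (e *+ (s + m * i) - zb)) ^+ 2) + d.
Proof.
move=> d0 hd; rewrite !corr_diff_block -lerBlDl -meanB.
have hd' : mean (fun p => `|block shift2 s m n p - block shift2 s' m' n' p|) <= d.
  by apply: mean_abs_le => //; apply: le_trans hd; apply: le_mean => p; rewrite expr2.
apply: le_trans hd'; apply: le_mean => p; rewrite -mulrBr.
apply: le_trans (ler_norm _) _; rewrite normrM distrC -[leRHS]mul1r ler_wpM2r //.
have w1 x : `|ind (x + za) - ind (x + zb)| <= 1.
  have /andP[a b] := ind01 R V (x + za); have /andP[c f] := ind01 R V (x + zb).
  by rewrite ler_norml; lra.
by rewrite normrM mulr_ile1.
Qed.

Lemma mean_block s m n : (0 < n)%N -> mean (block shift1 s m n) = mean ind.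
Proof.
move=> n0; rewrite /block exchange_mean.
under eq_mean => i do rewrite /shift1 (mean_shift ind).
by rewrite mean_cst ?card_ord.
Qed.

(** m n is the period by which sums wrap around; the hypothesis on the mean
    square says that shifting by it hardly changes the correlations. *)
Lemma block_inequality (U : pred nat) K n m p (th kap d2 d3 : R) :
  (0 < K)%N -> rough K n -> 0 < th -> 1 <= th * n%:R ->
  (forall i, (i < n)%N -> U (p + i)%N -> corr (e *+ (m * (p + i))) <= kap) ->
  0 <= kap -> 0 <= d2 ->
  mean (fun i : 'I_n => (corr (e *+ (m * (p + i)) - e *+ (m * n))
                         - corr (e *+ (m * (p + i)))) ^+ 2) <= d2 ^+ 2 ->
  mean (fun x => `|block shift1 0 m n x - block shift1 (m * p) m n x|) <= d3 ->
  th <= mean (fun i : 'I_n => (U (p + i)%N)%:R) ->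
  mean (fun i : 'I_n => (U (p + i)%N)%:R) + 2%:R * mean ind <=
  1 + 2%:R * th + 2%:R / K%:R + 4%:R * ((2%:R * kap + d2) / th) + d3.
Proof.
case: n => [|n]; first by rewrite mulr0 ler10.
move=> K0 rK th0 thn hU kap0 d20 hrec hbal hth.
set u := mean (fun i : 'I__ => (U (p + i)%N)%:R) in hth *.
pose A := [set i : 'I_n.+1 | U (p + i)%N].
pose B x := [set k : 'I_n.+1 | V (x + e *+ (0 + m * k))].
pose C x := [set k : 'I_n.+1 | V (x + e *+ (m * p + m * k))].
have N0 : 0 < n.+1%:R :> R by rewrite ltr0n.
have cardE (P : pred 'I_n.+1) : #|[set k | P k]|%:R / n.+1%:R = mean (fun k => (P k)%:R) :> R.
  rewrite /mean card_ord -sum1_card natr_sum big_mkcond; congr (_ / _).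
  by apply: eq_bigr => k _; rewrite inE; case: (P k).
have EA : #|A|%:R / n.+1%:R = u by rewrite cardE.
have EB x : #|B x|%:R / n.+1%:R = block shift1 0 m n.+1 x by rewrite cardE.
have EC x : #|C x|%:R / n.+1%:R = block shift1 (m * p) m n.+1 x by rewrite cardE.
pose pr x : R := (\sum_(z in C x) reps A (B x) z)%N%:R / n.+1%:R ^+ 2.
have ineq x : u + block shift1 0 m n.+1 x + block shift1 (m * p) m n.+1 x <=
    1 + 2%:R * th + 2%:R / K%:R + 4%:R / th * pr x
    + `|block shift1 0 m n.+1 x - block shift1 (m * p) m n.+1 x|.
  rewrite -EA -EB -EC.
  have -> : 4%:R / th * pr x = 4%:R * (pr x / th) by ring.
  apply: cyclic_sumset_inequality => //.
  by rewrite -ler_pdivlMr // EA.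
(* A pair (y, k) whose sum lies in C x is a coincidence of V with its
   translate by m (p + y) or, after wrap-around, by m (p + y) - m n. *)
have hpr : mean pr <= 2%:R * kap + d2.
  have prE x : pr x = mean (fun y : 'I_n.+1 => mean (fun k : 'I_n.+1 =>
      (U (p + y)%N)%:R * (V (x + e *+ (0 + m * k)))%:R *
      (V (x + e *+ (m * p + m * (k + y)%R)))%:R)).
    rewrite /pr /mean card_ord -mulr_suml expr2 invfM mulrA; congr (_ / _ / _).
    rewrite natr_sum big_mkcond /=.
    rewrite (eq_bigr (fun z : 'I_n.+1 => \sum_(y : 'I_n.+1) (U (p + y)%N)%:R * (V (x + e *+ (0 + m * (z - y)%R)))%:R *
       (V (x + e *+ (m * p + m * z)))%:R)); last first.
      move=> z _; rewrite inE; case: (V (x + _)); last first.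
        by rewrite big1 // => y _; rewrite mulr0.
      by rewrite /reps natr_sum; apply: eq_bigr => y _; rewrite mulr1 natrM !inE.
    rewrite exchange_big /=; apply: eq_bigr => y _.
    rewrite (reindex_inj (addIr y)); apply: eq_bigr => k _.
    by have ek := congr1 (@nat_of_ord _) (addrK y k); rewrite /= in ek *; rewrite ek.
  have prle x : pr x <= mean (fun y : 'I_n.+1 => mean (fun k : 'I_n.+1 =>
      (U (p + y)%N)%:R *
      (ind (x + e *+ (m * k)) * ind (x + e *+ (m * k) + e *+ (m * (p + y))) +
       ind (x + e *+ (m * k)) *
         ind (x + e *+ (m * k) + (e *+ (m * (p + y)) - e *+ (m * n.+1)))))).
    rewrite prE; apply: le_mean => y; apply: le_mean => k.
    rewrite -mulrA ler_wpM2l ?ler0n // -mulrDr add0n ler_wpM2l ?ler0n //.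
    have [lt|ge] := ltnP (k + y) n.+1.
      have -> : (m * p + m * (k + y)%R = m * k + m * (p + y))%N.
        by rewrite /= modn_small //; nia.
      rewrite mulrnDr addrA lerDl.
      by case/andP: (ind01 R V (x + e *+ (m * k) + (e *+ (m * (p + y)) - e *+ (m * n.+1)))).
    have e1 : x + e *+ (m * k) + (e *+ (m * (p + y)) - e *+ (m * n.+1)) =
        x + e *+ (m * p + m * (k + y)%R).
      rewrite -[LHS]addrA; congr (x + _); rewrite addrA -mulrnDr; apply/eqP.
      rewrite subr_eq -mulrnDr; apply/eqP; congr (_ *+ _).
      have lt2 : (k + y - n.+1 < n.+1)%N by have := ltn_ord k; have := ltn_ord y; lia.
      rewrite /= -(subnK ge) modnDr modn_small //; nia.
    by rewrite e1 lerDr; case/andP: (ind01 R V (x + e *+ (m * k) + e *+ (m * (p + y)))).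
  apply: le_trans (le_mean prle) _; rewrite exchange_mean.
  have -> : mean (fun y : 'I_n.+1 => mean (fun x => mean (fun k : 'I_n.+1 =>
      (U (p + y)%N)%:R *
      (ind (x + e *+ (m * k)) * ind (x + e *+ (m * k) + e *+ (m * (p + y))) +
       ind (x + e *+ (m * k)) *
         ind (x + e *+ (m * k) + (e *+ (m * (p + y)) - e *+ (m * n.+1))))))) =
    mean (fun y : 'I_n.+1 => (U (p + y)%N)%:R *
      (corr (e *+ (m * (p + y))) + corr (e *+ (m * (p + y)) - e *+ (m * n.+1)))).
    apply: eq_mean => y; rewrite exchange_mean.
    rewrite -[RHS](mean_cst (I := 'I_n.+1)) ?card_ord //; apply: eq_mean => k.
    rewrite meanZ; congr (_ * _).
    rewrite (mean_shift (fun x => ind x * ind (x + e *+ (m * (p + y))) +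
       ind x * ind (x + (e *+ (m * (p + y)) - e *+ (m * n.+1)))) (e *+ (m * k))).
    by rewrite meanD.
  apply: (@le_trans _ _ (mean (fun y : 'I_n.+1 => 2%:R * kap +
     `|corr (e *+ (m * (p + y)) - e *+ (m * n.+1)) - corr (e *+ (m * (p + y)))|))).
    apply: le_mean => y; case: (boolP (U _)) => [Uy|_]; last first.
      by rewrite mul0r addr_ge0 ?mulr_ge0.
    have := hU _ (ltn_ord y) Uy; rewrite mul1r.
    have := ler_norm (corr (e *+ (m * (p + y)) - e *+ (m * n.+1)) - corr (e *+ (m * (p + y)))).
    lra.
  rewrite meanD mean_cst ?card_ord // lerD2l.
  exact: mean_abs_le.
have := le_mean ineq.
rewrite !meanD !mean_cst ?cardG // !mean_block // meanZ => h.
have {}hpr : 4%:R / th * mean pr <= 4%:R / th * (2%:R * kap + d2).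
  by rewrite ler_wpM2l // divr_ge0 // ltW.
have -> : 4%:R * ((2%:R * kap + d2) / th) = 4%:R / th * (2%:R * kap + d2) by ring.
lra.
Qed.
End Shifts.

(** * The inequality for one region of scales *)

Section Regions.
Variable R : realFieldType.

(** The last Y places are left free because recurrence is also used for the
    block shifted by Y. *)
Lemma select_block (F : nat -> R) N n Y : (0 < n)%N -> (n + Y <= N)%N ->
  (forall k, 0 <= F k <= 1) ->
  exists2 p, (p + n + Y <= N)%N &
    mean (fun k : 'I_N => F k) <= mean (fun k : 'I_n => F (p + k)%N) + (n + Y)%:R / N%:R.
Proof.
move=> n0 nY F01; pose J := ((N - Y) %/ n)%N.
have J0 : (0 < J)%N by rewrite divn_gt0 //; lia.
have hJ : (n * J + Y <= N < n * J + (n + Y))%N.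
  have := divn_eq (N - Y) n; have := ltn_pmod (N - Y) n0; rewrite -/J mulnC; lia.
pose f (j : 'I_J) := \sum_(k < n) F (n * j + k)%N.
have [j hj] : exists j, mean f <= f j.
  have [|j hj] := exists_le_mean (fun j => -1 * f j); first by rewrite card_ord.
  by exists j; move: hj; rewrite meanZ; lra.
exists (n * j)%N; first by have := ltn_ord j; nia.
have Np : 0 < N%:R :> R by rewrite ltr0n; lia.
have np : 0 < n%:R :> R by rewrite ltr0n.
have Jp : 0 < J%:R :> R by rewrite ltr0n.
rewrite (mean_ord n (fun k => F (n * j + k)%N)) -/(f j) (mean_ord N F).
have hs : \sum_(k < N) F k <= J%:R * f j + (n + Y)%:R.
  have -> : N = (n * J + (N - n * J))%N by lia.
  rewrite big_split_ord /= sum_ord_mul exchange_big /=; apply: lerD.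
    move: hj; rewrite /mean card_ord ler_pdivrMr // mulrC; apply: le_trans.
    by rewrite le_eqVlt; apply/orP; left; apply/eqP; apply: eq_bigr => i _;
       apply: eq_bigr => k _; rewrite addnC.
  apply: (@le_trans _ _ (\sum_(k < N - n * J) 1)).
    by apply: ler_sum => k _; case/andP: (F01 (n * J + k)%N).
  by rewrite sumr_const card_ord ler_nat; lia.
rewrite ler_pdivrMr //; apply: le_trans hs _.
rewrite mulrDl divfK ?gt_eqF // lerD2r.
have fj0 : 0 <= f j / n%:R.
  by rewrite divr_ge0 ?(ltW np) // sumr_ge0 // => k _; case/andP: (F01 (n * j + k)%N).
have -> : J%:R * f j = f j / n%:R * (n * J)%:R by rewrite natrM mulrA divfK ?gt_eqF // mulrC.
by rewrite ler_wpM2l // ler_nat; lia.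
Qed.

(** If d divides H then the product is -1 modulo d. *)
Lemma rough_power K H y c : (0 < H)%N ->
  (forall d, (1 < d < K)%N -> (d %| H)%N) -> (0 < y)%N -> (0 < c)%N ->
  rough K ((1 + H ^ y) * (H ^ c - 1)).
Proof.
move=> H0 hH y0 c0 d dn d1; rewrite leqNgt; apply/negP => dK.
have dH : (d %| H)%N by apply: hH; rewrite d1.
have dX k : (0 < k)%N -> (d %| H ^ k)%N by move=> k0; apply: dvdn_trans dH (dvdn_exp _ _).
have Hc : (0 < H ^ c)%N by rewrite expn_gt0 H0.
have : (d %| (1 + H ^ y) * (H ^ c - 1) + 1 + H ^ y)%N.
  have -> : ((1 + H ^ y) * (H ^ c - 1) + 1 + H ^ y = (1 + H ^ y) * H ^ c)%N.
    by rewrite mulnBr muln1; move: (H ^ y)%N (H ^ c)%N Hc => a b; nia.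
  by rewrite dvdn_mull // dX.
rewrite -addnA dvdn_addr // dvdn_addl ?dX // dvdn1 => /eqP; lia.
Qed.

(** The elementary arithmetic of the scales, for a step H ^ (i + c) between H
    ^ i and H ^ (i + R') and for lengths between H ^ l and H ^ L. *)
Section Powers.
Local Open Scope nat_scope.
Variables (H i R' l y c : nat).
Hypotheses (H4 : 4 <= H) (jl : i + R' <= l) (ly : l + 2 <= y) (cR : c < R').
Local Notation L := (y + (i + R')).

Lemma powers_split :
  [/\ H ^ (R' - c) * H ^ (l - (i + R')) = H ^ (l - (i + c)),
      H ^ (l - (i + c)) * H ^ (L - l) = H ^ (L - (i + c)),
      H ^ c * H ^ (R' - c) * (H ^ (l - (i + R')) * H ^ (L - l)) = H ^ (L - i),
      H ^ i * (H ^ c * H ^ (R' - c)) = H ^ (i + R') &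
      H ^ i * H ^ c = H ^ (i + c)].
Proof. by rewrite -!expnD; split; congr expn; lia. Qed.

Lemma powers_tile n : H ^ y <= n ->
  (H ^ (l - (i + c)) * H <= n) && (4 * H ^ (l - (i + c)) <= n).
Proof.
move=> yn; have hT : H ^ (l - (i + c)) * H <= n.
  by apply: leq_trans yn; rewrite -expnSr leq_exp2l; lia.
by rewrite hT; apply: leq_trans hT; rewrite mulnC leq_mul2l H4 orbT.
Qed.

Lemma powers_window : H ^ c * H ^ (L - (i + c)) = H ^ R' * H ^ y.
Proof. by rewrite -!expnD; congr expn; lia. Qed.

Lemma powers_period c' : c < c' < R' ->
  let Y := 1 + H ^ y in let n := Y * (H ^ (c' - c) - 1) in
  [/\ H ^ y <= n, n + Y <= H ^ (L - (i + c)),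
      (n + Y) * H <= 2 * H ^ (L - (i + c)),
      Y * H ^ (i + c') = H ^ (i + c) * (Y + n) & H ^ L = H ^ (i + c) * H ^ (L - (i + c))].
Proof.
case/andP=> lt c'R Y n.
have Hcc : H <= H ^ (c' - c) by rewrite -{1}[H]expn1 leq_exp2l; lia.
have y0 : 0 < H ^ y by rewrite expn_gt0; lia.
have enY : n + Y = Y * H ^ (c' - c).
  by rewrite /n -mulnSr -subSn ?subn1 // expn_gt0 (leq_trans _ H4).
have hnY : (n + Y) * H <= 2 * H ^ (L - (i + c)).
  rewrite enY; apply: (@leq_trans (2 * H ^ y * H ^ (c' - c) * H)).
    by rewrite !leq_mul2r /Y mul2n -addnn leq_add2r y0 !orbT.
  rewrite -!mulnA leq_mul2l /= -expnSr -expnD leq_exp2l; lia.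
split=> //.
- by rewrite /n /Y; move: (H ^ (c' - c)) (H ^ y) Hcc y0 => a b; nia.
- by move: (H ^ (L - (i + c))) (n + Y) hnY => a b; nia.
- rewrite [Y + n]addnC enY; have -> : i + c' = (i + c) + (c' - c) by lia.
  by rewrite expnD mulnCA.
- by rewrite -expnD; congr expn; lia.
Qed.
End Powers.

(** A region of scales: the steps are H ^ (i + c) with c < R', the coarse
    blocks have step H ^ i and extent H ^ L, the fine ones have step H ^ (i +
    R') and extent H ^ l. The tolerances are: th, the least density of S that
    counts as positive; kap, the correlation allowed at elements of S; delta
    and d2, for the recurrence in coarse blocks and in blocks of step H ^ (i +
    c); d', for the distance between block averages; eg, for the energy
    gaps. *)
Section OneRegion.
Variables (G : finZmodType) (e : G) (V : pred G) (S : pred nat).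
Variables (H K i R' l y M : nat) (th kap delta d' d2 eg : R).
Local Notation ind := (ind R V).
Local Notation corr := (corr R V).
Local Notation X1 := (shift1 R e V).
Local Notation X2 := (shift2 R e V).
Local Notation j := (i + R')%N.
Local Notation L := (y + (i + R'))%N.

Definition prog_density a b : R := mean (fun k : 'I_(H ^ b) => (S (H ^ a * k)%N)%:R).

(** The first alternative cannot be merged with the second: a region which S
    hardly meets does not bound the density of V, and the bound by 1/2 valid
    for any sum-free set takes over. *)
Definition good_scale (c : nat) :=
  (prog_density (i + c) (L - (i + c)) <= th + 2%:R / H%:R) ||
  (prog_density (i + c) (L - (i + c)) + 2%:R * mean ind <=
     1 + 2%:R * th + 2%:R / K%:R + 4%:R * ((2%:R * kap + d2) / th) + 2%:R * d' + 2%:R / H%:R).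

Hypothesis H4 : (4 <= H)%N.
Hypothesis K0 : (0 < K)%N.
Hypothesis hH : forall d, (1 < d < K)%N -> (d %| H)%N.
Hypothesis jl : (j <= l)%N.
Hypothesis ly : (l + 2 <= y)%N.
Hypothesis M0 : (0 < M)%N.
Hypothesis delta0 : 0 < delta.
Hypothesis d'0 : 0 <= d'.
Hypothesis d20 : 0 <= d2.
Hypothesis kap0 : 0 <= kap.
Hypothesis th0 : 0 < th.
Hypothesis thH : 1 <= th * H%:R.
Hypothesis gap1 : sqnorm (block X1 0 (H ^ j) (H ^ (l - j))) -
                  sqnorm (block X1 0 (H ^ i) (H ^ (L - i))) <= eg.
Hypothesis gap2 : sqnorm (block X2 0 (H ^ j) (H ^ (l - j))) -
                  sqnorm (block X2 0 (H ^ i) (H ^ (L - i))) <= eg.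
Hypothesis heg : 4%:R * (H ^ R')%:R * eg + 32%:R * (H%:R^-1) ^+ 2 <= d' ^+ 2.
Hypothesis hd2 : 4%:R * delta + d' <= d2 ^+ 2.
Hypothesis hU : forall t, (t < H ^ L)%N -> S t -> corr (e *+ t) <= kap.

Let HX k : (0 < H ^ k)%N.
Proof. by rewrite expn_gt0 (leq_trans _ H4). Qed.

(** The extent n H^(i + c) of the block is at least H^-R' times the extent H^L
    of the coarse block, and at least H times the extent H^l of a tile. *)
Lemma close_region (D : finType) (X : nat -> D -> R) c p n :
  (0 < #|D|)%N ->
  (forall i j k, dot (X (i + k)%N) (X (j + k)%N) = dot (X i) (X j)) ->
  (forall k d, `|X k d| <= 1) ->
  sqnorm (block X 0 (H ^ j) (H ^ (l - j))) - sqnorm (block X 0 (H ^ i) (H ^ (L - i))) <= eg ->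
  (c < R')%N -> (H ^ y <= n)%N -> (p + n <= H ^ (L - (i + c)))%N ->
  sqnorm (fun d => block X 0 (H ^ i) (H ^ (L - i)) d - block X (H ^ (i + c) * p) (H ^ (i + c)) n d)
  <= d' ^+ 2.
Proof.
move=> D0 st X1 gap cR yn pn.
have [eT eTJ eN em em0] := powers_split H4 jl ly cR.
have /andP[hT h4T] := powers_tile H4 jl ly cR yn.
have np : 0 < n%:R :> R by rewrite ltr0n; apply: leq_trans yn.
have Hp : 0 < H%:R :> R by rewrite ltr0n (leq_trans _ H4).
have := @block_close R D D0 X st X1 (H ^ i) (H ^ c) (H ^ (R' - c)) (H ^ (l - j)) (H ^ (L - l)) p n
   (HX _) (HX _) (HX _).
rewrite eT eTJ eN em em0 => /(_ h4T pn) /le_trans; apply; apply: le_trans heg.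
have gap0 : 0 <= sqnorm (block X 0 (H ^ j) (H ^ (l - j))) - sqnorm (block X 0 (H ^ i) (H ^ (L - i))).
  by rewrite subr_ge0 -em -eN sqnorm_blk_le // muln_gt0 ?HX.
apply: lerD.
  rewrite -mulrA; rewrite -[leRHS]mulrA ler_wpM2l //.
  apply: (@le_trans _ _ ((H ^ R')%:R * (sqnorm (block X 0 (H ^ j) (H ^ (l - j))) -
     sqnorm (block X 0 (H ^ i) (H ^ (L - i)))))); last by rewrite ler_wpM2l.
  rewrite ler_wpM2r // -natrM ler_pdivrMr // -natrM ler_nat.
  by rewrite (powers_window H4 jl ly cR) leq_mul2l yn orbT.
rewrite ler_wpM2l // ler_pXn2r ?nnegrE ?divr_ge0 ?invr_ge0 ?ler0n //.
by rewrite ler_pdivrMr // mulrC ler_pdivlMr // -natrM ler_nat.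
Qed.

(** The block length n is chosen such that H ^ (i + c) * n is the difference
    of the two partner shifts; the correlations recur along it. *)
Lemma partner_good (c c' : 'I_R') : (c < c')%N ->
  mean (fun k : 'I_(H ^ (L - i)) =>
    (corr (e *+ (0 + H ^ i * k) - e *+ ((1 + H ^ y) * H ^ (i + c)))
   - corr (e *+ (0 + H ^ i * k) - e *+ ((1 + H ^ y) * H ^ (i + c')))) ^+ 2) <= 4%:R * delta ->
  good_scale c.
Proof.
move=> lt hrec; pose Y := (1 + H ^ y)%N; pose n := (Y * (H ^ (c' - c) - 1))%N.
pose m := (H ^ (i + c))%N; pose N := (H ^ (L - (i + c)))%N.
have cc'R : (c < c' < R')%N by rewrite lt ltn_ord.
have [n0 nYN hnY eY eL] := powers_period H4 jl ly (ltn_ord c) cc'R.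
rewrite -/Y -/n -/m -/N in n0 nYN hnY eY eL.
have npos : (0 < n)%N by apply: leq_trans n0.
have S01 k : 0 <= ((S (m * k)%N)%:R : R) <= 1 by case: (S _); rewrite ?lexx ler01.
have [p hp hsel] := @select_block (fun k => (S (m * k)%N)%:R) _ _ _ npos nYN S01.
have Hp : 0 < H%:R :> R by rewrite ltr0n (leq_trans _ H4).
have Np : 0 < N%:R :> R by rewrite ltr0n HX.
have hsel2 : (n + Y)%:R / N%:R <= 2%:R / H%:R :> R.
  by rewrite ler_pdivrMr // mulrAC ler_pdivlMr // -!natrM ler_nat.
have [hth|hth] := leP (mean (fun k : 'I_n => (S (m * (p + k))%N)%:R)) th.
  by apply/orP; left; rewrite /prog_density -/m -/N; lra.
apply/orP; right; rewrite /prog_density -/m -/N.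
suff : mean (fun k : 'I_n => (S (m * (p + k))%N)%:R) + 2%:R * mean ind <=
   1 + 2%:R * th + 2%:R / K%:R + 4%:R * ((2%:R * kap + d2) / th) + 2%:R * d' by lra.
have cl1 p' : (p' + n <= N)%N -> _ :=
  @close_region _ X1 c p' n (cardG G) (@shift1_stat R G e V) (shift1_le1 R e V) gap1 (ltn_ord c) n0.
have cGG : (0 < #|{: G * G}|)%N by rewrite card_prod muln_gt0 cardG.
have cl2 p' : (p' + n <= N)%N -> _ :=
  @close_region _ X2 c p' n cGG (@shift2_stat R G e V) (shift2_le1 R e V) gap2 (ltn_ord c) n0.
have pn : (p + n <= N)%N by apply: leq_trans hp; rewrite leq_addr.
have pYn : (p + Y + n <= N)%N by rewrite addnAC.
have zn : (0 + n <= N)%N by apply: leq_trans pn; rewrite leq_add2r.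
apply: (@block_inequality R G e V (fun k => S (m * k)%N) K n m p th kap d2) => //.
- apply: rough_power => //; [exact: leq_trans H4| |by rewrite subn_gt0].
  by apply: leq_trans ly; rewrite addn2.
- apply: le_trans thH _; rewrite ler_wpM2l ?(ltW th0) // ler_nat.
  apply: leq_trans n0; rewrite -{1}[H]expn1 leq_exp2l ?(leq_trans _ H4) //.
  by apply: leq_trans ly; rewrite addn2.
- move=> k kn Sk; apply: hU => //.
  rewrite eL ltn_pmul2l ?HX //; apply: leq_trans pn; by rewrite ltn_add2l.
- apply: le_trans hd2.
  have hc := corr_diff_close (e *+ (Y * H ^ (i + c))) (e *+ (Y * H ^ (i + c'))) d'0 (cl2 _ pYn).
  have hc' : mean (fun k : 'I_n => (corr (e *+ (m * (p + Y) + m * k) - e *+ (Y * H ^ (i + c)))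
     - corr (e *+ (m * (p + Y) + m * k) - e *+ (Y * H ^ (i + c')))) ^+ 2) <= 4%:R * delta + d'.
    by apply: le_trans hc _; rewrite lerD2r.
  apply: le_trans hc'; rewrite le_eqVlt; apply/orP; left; apply/eqP; apply: eq_mean => k.
  have e1 : (m * (p + Y) + m * k = m * (p + k) + Y * m)%N.
    by rewrite [(Y * m)%N]mulnC -!mulnDr addnAC.
  have e2 : e *+ (m * (p + Y) + m * k) - e *+ (Y * H ^ (i + c)) = e *+ (m * (p + k)).
    by rewrite e1 mulrnDr -/m addrK.
  have e3 : e *+ (m * (p + Y) + m * k) - e *+ (Y * H ^ (i + c')) =
            e *+ (m * (p + k)) - e *+ (m * n).
    rewrite e1 eY -/m [(Y * m)%N]mulnC (mulnDr m Y n).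
    rewrite (mulrnDr e (m * (p + k))) (mulrnDr e (m * Y)).
    by rewrite opprD addrA addrK.
  by rewrite e2 e3 -sqrrN opprB.
- have d'2 : 0 <= 2%:R * d' by rewrite mulr_ge0.
  apply: mean_abs_le => //.
  have h1 := cl1 _ zn; have h2 := cl1 _ pn.
  rewrite muln0 in h1.
  have := sqnormB_le (block X1 0 m n) (block X1 0 (H ^ i) (H ^ (L - i))) (block X1 (m * p) m n).
  have -> : sqnorm (fun d => block X1 0 m n d - block X1 0 (H ^ i) (H ^ (L - i)) d) =
            sqnorm (fun d => block X1 0 (H ^ i) (H ^ (L - i)) d - block X1 0 m n d).
    by rewrite /sqnorm /dot; apply: eq_mean => x; ring.
  rewrite exprMn /sqnorm /dot -/m in h1 h2 *.
  under eq_mean => x do rewrite -expr2.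
  move=> h3; apply: le_trans h3 _; rewrite -/m; lra.
exact: ltW.
Qed.

Lemma few_bad_scales :
  #|[set c : 'I_R' | ~~ good_scale c]|%:R <= (2 ^ M)%:R + R'%:R / (M%:R * delta).
Proof.
have := @few_nonrecurrent R G V R' (H ^ (L - i)) (fun c => e *+ ((1 + H ^ y) * H ^ (i + c)))
   (fun k => e *+ (0 + H ^ i * k)) M delta M0 delta0.
apply: le_trans; rewrite ler_nat; apply: subset_leq_card; apply/subsetP => c.
rewrite !inE; apply: contra => /existsP[c' /andP[lt h]].
exact: partner_good lt h.
Qed.
End OneRegion.
End Regions.

(** * Regions with nearly constant energy *)

Definition sumfree_nat (S : pred nat) := forall x y, S x -> S y -> ~~ S (x + y)%N.

Section SumFreeNat.
Variables (R : realFieldType) (S : pred nat).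
Hypothesis Sf : sumfree_nat S.

(** If n is in S, at most one of k and n - k is in S. *)
Lemma sumfree_half n : 2%:R * mean (fun x : 'I_n => (S x)%:R) <= 1 :> R.
Proof.
elim: n => [|n IH]; first by rewrite (mean_ord 0 (fun x => (S x)%:R)) big_ord0 mul0r mulr0 ler01.
have n0 : 0 < n.+1%:R :> R by rewrite ltr0n.
rewrite (mean_ord n.+1 (fun x => (S x)%:R)) mulrA ler_pdivrMr // mul1r.
have [Sn|nSn] := boolP (S n); last first.
  rewrite big_ord_recr /= (negbTE nSn) addr0; case: n {n0 nSn} IH => [|n] IH.
    by rewrite big_ord0 mulr0 ler0n.
  apply: (@le_trans _ _ n.+1%:R); last by rewrite ler_nat.
  move: IH; rewrite (mean_ord n.+1 (fun x => (S x)%:R)) mulrA ler_pdivrMr ?ltr0n //.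
  by rewrite mul1r.
rewrite mulr_natl mulr2n {2}(reindex_inj rev_ord_inj) /= -big_split /=.
apply: (@le_trans _ _ (\sum_(i < n.+1) 1)); last by rewrite sumr_const card_ord.
apply: ler_sum => i _; rewrite subSS.
have := ltn_ord i; rewrite ltnS => le_in.
case: (boolP (S i)) => Si; case: (boolP (S (n - i)%N)) => Sni //; rewrite ?addr0 ?add0r //=.
by have := Sf Si Sni; rewrite subnKC // Sn.
Qed.

Lemma sum_overflow N t : (t <= N)%N -> (\sum_(x < N) (N <= x + t) <= t)%N.
Proof.
move=> tN; have [k ->] : exists k, N = (k + t)%N by exists (N - t)%N; rewrite subnK.
rewrite big_split_ord /= big1 ?add0n => [|x _]; last first.
  by rewrite leq_add2r leqNgt ltn_ord.
apply: (@leq_trans (\sum_(x < t) 1)%N); last by rewrite sum1_card card_ord.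
by apply: leq_sum => x _; exact: leq_b1.
Qed.

(** If x is in S and x + t does not wrap around modulo n + 1, then x + t is
    not in S; it wraps around for the last t points x only. *)
Lemma corr_shift n (t : nat) : (t <= n.+1)%N -> S t ->
  corr R (fun x : 'I_n.+1 => S x) (Zp1 *+ t) <= t%:R / n.+1%:R.
Proof.
move=> tn St; rewrite /corr /mean card_ord ler_wpM2r ?invr_ge0 ?ler0n //.
have vE (x : 'I_n.+1) : val (x + Zp1 *+ t) = ((x + t) %% n.+1)%N.
  by rewrite Zp_mulrn /= modnDmr -modnDmr modnMml mul1n modnDmr.
apply: (@le_trans _ _ (\sum_(x < n.+1) (n.+1 <= x + t)%N%:R)).
  apply: ler_sum => x _; rewrite /ind vE.
  have [le|lt] := leqP n.+1 (x + t).
    by case: (S x); case: (S _); rewrite ?mulr1 ?mul1r ?mul0r ?lexx ?ler01.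
  rewrite modn_small //; case: (boolP (S x)) => Sx; last by rewrite mul0r.
  by rewrite (negbTE (Sf Sx St)) mulr0.
by rewrite -natr_sum ler_nat; apply: sum_overflow.
Qed.
End SumFreeNat.

Section Scales.
Variable R : realFieldType.

Lemma mean_good_bad (I : finType) (F : I -> R) (good : pred I) a b :
  (0 < #|I|)%N -> 0 <= b -> (forall i, good i -> F i <= a) -> (forall i, F i <= a + b) ->
  mean F <= a + b * (#|[set i | ~~ good i]|%:R / #|I|%:R).
Proof.
move=> I0 b0 Fg Fb; rewrite -[X in X + _](mean_cst a I0).
have -> : b * (#|[set i | ~~ good i]|%:R / #|I|%:R) = mean (fun i => b * (~~ good i)%:R).
  rewrite meanZ /mean -sum1_card natr_sum big_mkcond /=; congr (_ * (_ / _)).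
  by apply: eq_bigr => i _; rewrite inE; case: (good i).
rewrite -meanD; apply: le_mean => i.
by case: (boolP (good i)) => /= gi; rewrite ?mulr0 ?addr0 ?mulr1 ?Fg.
Qed.

(** The gaps telescope to at most 1. *)
Lemma few_large_gaps (E : nat -> R) n eg : 0 < eg ->
  (forall r, (r < n)%N -> E r <= E r.+1) -> 0 <= E 0%N -> E n <= 1 ->
  #|[set r : 'I_n | eg < E r.+1 - E r]|%:R <= eg^-1.
Proof.
move=> eg0 mono E0 En; rewrite -div1r ler_pdivlMr //.
have := @card_markov R 'I_n (fun r => E r.+1 - E r) eg eg0.
move=> /(_ (fun r => ltac:(by rewrite subr_ge0 mono))) /le_trans; apply.
rewrite -(big_mkord xpredT (fun r => E r.+1 - E r)) telescope_sumr //; lra.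
Qed.

(** With t = 1 / p, the tolerances of a region are th = t, kap = t^2 / 4,
    delta = t^4 / 32, d' = t^4 / 8, d2 = t^2 / 2 and eg = t^8 / (512 H^R').
    Then R' is so large that a proportion at least 1 - t of the steps of a
    region recur, and Rg, the number of regions, so large that a proportion at
    least 1 - t of the regions have both gaps at most eg. *)
Variables (p H K R' M Rg W N : nat) (S : pred nat).
Hypotheses (p0 : (0 < p)%N) (hK : K = (64 * p ^ 4)%N) (KH : (K <= H)%N).
Hypothesis hH : forall d, (1 < d < K)%N -> (d %| H)%N.
Hypotheses (hM : M = (64 * p ^ 5)%N) (hR' : R' = (2 * p * 2 ^ M)%N).
Hypothesis hRg : Rg = (p * (1024 * p ^ 8 * H ^ R'))%N.
Hypotheses (hW : W = (Rg * R' + 2)%N) (hN : N = (4 * p ^ 2 * H ^ (Rg.+1 * W))%N).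
Hypothesis Sf : sumfree_nat S.

Local Notation P := (p%:R : R).
(** The extent of the coarse blocks of region r is H ^ level r, and its fine
    blocks have the step and the extent of the coarse blocks of region r + 1.
    The extents decrease while the steps increase, which makes the energy
    monotone along the chain. *)
Definition level r := ((Rg.+1 - r) * W)%N.

Lemma level_facts r : (r < Rg)%N ->
  let l := level r.+1 in let y := (level r - (r * R' + R'))%N in
  [/\ (r * R' + R' <= l)%N, (l + 2 <= y)%N, (y + (r * R' + R') = level r)%N & (level r <= Rg.+1 * W)%N].
Proof.
move=> rR l y; have hl : (level r = l + W)%N.
  by rewrite /level /l /level subSS subSn ?(ltnW rR) // mulSn addnC.
have hr : (r * R' + R' <= Rg * R')%N by rewrite addnC -mulSn leq_mul2r rR orbT.
have hl' : (W <= l)%N.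
  by rewrite /l /level subSS leq_pmull // subn_gt0.
have hL : (level r <= Rg.+1 * W)%N by rewrite /level leq_mul2r leq_subr orbT.
have hWr : (r * R' + R' + 2 <= W)%N by rewrite hW leq_add2r.
move: hl hWr hl' hL; rewrite -/l /y; move: l (level r) (r * R' + R')%N (Rg.+1 * W)%N W.
by clear=> l' lv a b w -> h1 h2 h3; split; lia.
Qed.

Local Notation t := (P^-1).

Lemma scale_consts : [/\ 0 < t, t <= 1, H%:R^-1 <= t ^+ 4 / 64%:R :> R,
  K%:R^-1 = t ^+ 4 / 64%:R :> R & M%:R = 64%:R * P ^+ 5 :> R].
Proof.
have Pp : 0 < P by rewrite ltr0n.
have P1 : 1 <= P by rewrite ler1n.
have Kp : 0 < K%:R :> R by rewrite ltr0n hK muln_gt0 expn_gt0 p0.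
have eK : K%:R^-1 = t ^+ 4 / 64%:R :> R by rewrite hK natrM natrX invfM exprVn mulrC.
split=> //.
- by rewrite invr_gt0.
- by rewrite invf_le1.
- by rewrite -eK lef_pV2 ?posrE ?ler_nat // (lt_le_trans Kp) // ler_nat.
- by rewrite hM natrM natrX.
Qed.

Lemma scale_average :
  mean (fun r : 'I_Rg => mean (fun c : 'I_R' =>
     prog_density R S H (r * R' + c) (level r - (r * R' + c))))
  + 2%:R * mean (fun x : 'I_N => (S x)%:R) <= 1 + 13%:R * t.
Proof.
have [t0 t1 Ht Kt eM] := scale_consts.
have t4 : t ^+ 4 <= t by rewrite exprS ler_piMr ?(ltW t0) // exprn_ile1 ?(ltW t0).
have Hp : 0 < H%:R :> R.
  by rewrite ltr0n (leq_trans _ KH) // hK muln_gt0 expn_gt0 p0.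
have Pn0 : P != 0 by rewrite pnatr_eq0 -lt0n.
have Pt : P * t = 1 by rewrite divff.
have N0 : (0 < N)%N.
  rewrite hN !muln_gt0 !expn_gt0 p0 (leq_trans _ KH) //.
  by rewrite hK muln_gt0 expn_gt0 p0.
have H4 : (4 <= H)%N.
  by apply: leq_trans KH; rewrite hK (@leq_trans 64) // leq_pmulr // expn_gt0 p0.
have K0 : (0 < K)%N by rewrite hK muln_gt0 expn_gt0 p0.
have M0 : (0 < M)%N by rewrite hM muln_gt0 expn_gt0 p0.
have R'0 : (0 < R')%N by rewrite hR' !muln_gt0 expn_gt0 p0.
have HR0 : (0 < H ^ R')%N by rewrite expn_gt0 (leq_trans _ H4).
have Rg0 : (0 < Rg)%N by rewrite hRg muln_gt0 p0 muln_gt0 HR0 muln_gt0 expn_gt0 p0.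
case: N N0 hN => // n _ hN'.
set v := mean (fun x : 'I_n.+1 => (S x)%:R).
have v1 : 2%:R * v <= 1 by apply: sumfree_half.
pose V : pred 'I_n.+1 := fun x => S x.
pose e : 'I_n.+1 := Zp1.
have vE : mean (ind R V) = v by [].
pose eg : R := t ^+ 8 / 512%:R * (H ^ R')%:R^-1.
have HRp : 0 < (H ^ R')%:R :> R by rewrite ltr0n.
have eg0 : 0 < eg.
  by rewrite /eg mulr_gt0 ?invr_gt0 // divr_gt0 // exprn_gt0.
pose dens (r c : nat) := prog_density R S H (r * R' + c) (level r - (r * R' + c)).
have dens1 r c : dens r c <= 1.
  by apply: mean_le_cst => // k; case: (S _).
pose E (D : finType) (X : nat -> D -> R) r :=
  sqnorm (block X 0 (H ^ (r * R')) (H ^ (level r - r * R'))).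
pose gap (D : finType) (X : nat -> D -> R) r := E D X r.+1 - E D X r.
have Emono (D : finType) (X : nat -> D -> R) r : (0 < #|D|)%N ->
    (forall i j k, dot (X (i + k)%N) (X (j + k)%N) = dot (X i) (X j)) ->
    (r < Rg)%N -> E D X r <= E D X r.+1.
  move=> D0 st rR; have [h1 h2 h3 h4] := level_facts rR.
  rewrite /E; have -> : (H ^ (level r - r * R') =
     H ^ R' * (H ^ (level r.+1 - r.+1 * R') * H ^ (level r - level r.+1)))%N.
    rewrite -!expnD; congr expn; rewrite mulSnr.
    move: h1 h2 h3 h4; move: (level r) (level r.+1) (r * R')%N R' => a b c d.
    by clear; lia.
  have -> : (H ^ (r.+1 * R') = H ^ (r * R') * H ^ R')%N by rewrite mulSnr expnD.
  by apply: sqnorm_blk_le => //; rewrite expn_gt0 (leq_trans _ H4).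
have E1 (D : finType) (X : nat -> D -> R) r : (0 < #|D|)%N ->
    (forall k d, `|X k d| <= 1) -> E D X r <= 1.
  move=> D0 X1; rewrite -[leRHS](expr1n _ 2); apply: sqnorm_sup => // d.
  exact: block_sup.
have cGG : (0 < #|{: 'I_n.+1 * 'I_n.+1}|)%N by rewrite card_prod card_ord.
have cG : (0 < #|'I_n.+1|)%N by rewrite card_ord.
pose X1 := shift1 R e V; pose X2 := shift2 R e V.
pose goodr (r : 'I_Rg) := (gap _ X1 r <= eg) && (gap _ X2 r <= eg).
pose goodc (r : 'I_Rg) (c : 'I_R') := dens r c + 2%:R * v <= 1 + 11%:R * t.
have Hgoodc r : goodr r -> #|[set c | ~~ goodc r c]|%:R / R'%:R <= t.
  case/andP=> g1 g2; have [h1 h2 h3 h4] := level_facts (ltn_ord r).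
  set l := level r.+1 in h1 h2; set y := (level r - (r * R' + R'))%N in h2 h3.
  have l1 : (level r.+1 - r.+1 * R' = l - (r * R' + R'))%N by rewrite mulSnr.
  have hreg : #|[set c : 'I_R' | ~~ good_scale V S H K (r * R') R' y t
      (t ^+ 2 / 4%:R) (t ^+ 4 / 8%:R) (t ^+ 2 / 2%:R) c]|%:R <=
      (2 ^ M)%:R + R'%:R / (M%:R * (t ^+ 4 / 32%:R)).
    apply: (@few_bad_scales R 'I_n.+1 e V S H K (r * R') R' l y M t _ _ _ _ eg) => //.
    - by rewrite divr_gt0 ?exprn_gt0.
    - by rewrite divr_ge0 ?exprn_ge0 ?(ltW t0).
    - by rewrite divr_ge0 ?exprn_ge0 ?(ltW t0).
    - by rewrite divr_ge0 ?exprn_ge0 ?(ltW t0).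
    - by rewrite -ler_pdivrMr // div1r; lra.
    - by move: g1; rewrite /gap /E l1 mulSnr h3.
    - by move: g2; rewrite /gap /E l1 mulSnr h3.
    - have -> : 4%:R * (H ^ R')%:R * eg = t ^+ 8 / 128%:R.
        by rewrite /eg; field; rewrite ?Pn0 ?(gt_eqF HRp).
      have : H%:R^-1 ^+ 2 <= (t ^+ 4 / 64%:R) ^+ 2.
        by rewrite ler_pXn2r ?nnegrE ?invr_ge0 ?ler0n // divr_ge0 ?exprn_ge0 ?(ltW t0).
      rewrite !expr_div_n -!exprM; lra.
    - by rewrite expr_div_n -exprM; lra.
    - move=> s; rewrite h3 => sL Ss.
      have sN : (s <= H ^ (Rg.+1 * W))%N.
        by apply: ltnW; apply: leq_trans sL _; rewrite leq_exp2l ?(leq_trans _ H4).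
      have sn : (s <= n.+1)%N.
        by rewrite hN'; apply: leq_trans sN _; rewrite leq_pmull // muln_gt0 expn_gt0 p0.
      apply: le_trans (corr_shift R Sf sn Ss) _.
      rewrite ler_pdivrMr ?ltr0n // hN' (natrM _ (4 * p ^ 2)) (natrM _ 4) (natrX _ p 2).
      have -> : t ^+ 2 / 4%:R * (4%:R * P ^+ 2 * (H ^ (Rg.+1 * W))%:R) =
         (P * t) ^+ 2 * (H ^ (Rg.+1 * W))%:R by field; rewrite ?Pn0.
      by rewrite Pt expr1n mul1r ler_nat.
  rewrite ler_pdivrMr ?ltr0n //; apply: (@le_trans _ _ _ _ _ _ (le_trans hreg _)).
    rewrite ler_nat; apply: subset_leq_card; apply/subsetP => c.
    rewrite !inE; apply: contra => /orP[]; rewrite h3 /goodc /dens.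
      by have := dens1 r c; rewrite /dens; lra.
    have -> : (2%:R * (t ^+ 2 / 4%:R) + t ^+ 2 / 2%:R) / t = t.
      by field; rewrite ?Pn0.
    by rewrite vE Kt; lra.
  have -> : M%:R * (t ^+ 4 / 32%:R) = 2%:R * P.
    have -> : 2%:R * P = 2%:R * P * (P * t) ^+ 4 by rewrite Pt expr1n mulr1.
    by rewrite eM; field; rewrite gt_eqF // -invr_gt0.
  have -> : R'%:R / (2%:R * P) = (2 ^ M)%:R.
    by rewrite hR' !natrM mulrC mulKf // mulf_neq0 ?pnatr_eq0 -?lt0n.
  rewrite hR' !natrM.
  have -> : t * (2%:R * P * (2 ^ M)%:R) = (P * t) * (2%:R * (2 ^ M)%:R) by ring.
  by rewrite Pt; lra.
have Hgoodr : #|[set r | ~~ goodr r]|%:R / Rg%:R <= t.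
  have g1 := few_large_gaps eg0 (fun r => Emono _ X1 r cG (shift1_stat R e V)) (sqnorm_ge0 _)
    (E1 _ _ _ cG (shift1_le1 R e V)).
  have g2 := few_large_gaps eg0 (fun r => Emono _ X2 r cGG (shift2_stat R e V)) (sqnorm_ge0 _)
    (E1 _ _ _ cGG (shift2_le1 R e V)).
  have hc : #|[set r | ~~ goodr r]|%:R <= eg^-1 + eg^-1.
    apply: le_trans (lerD g1 g2); rewrite -natrD ler_nat.
    apply: leq_trans (leq_card_setU _ _); apply: subset_leq_card; apply/subsetP => r.
    by rewrite !inE /goodr negb_and -!ltNge.
  rewrite ler_pdivrMr ?ltr0n //; apply: le_trans hc _.
  rewrite hRg (natrM _ p) (natrM _ (1024 * p ^ 8)) (natrM _ 1024) (natrX _ p 8).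
  have -> : eg^-1 = 512%:R * P ^+ 8 * (H ^ R')%:R.
    by rewrite /eg; field; rewrite ?Pn0 ?(gt_eqF HRp).
  have -> : t * (P * (1024%:R * P ^+ 8 * (H ^ R')%:R)) = (P * t) * (1024%:R * P ^+ 8 * (H ^ R')%:R).
    by ring.
  by rewrite Pt; lra.
rewrite -[X in _ + X](mean_cst (I := 'I_Rg)) ?card_ord // -meanD.
apply: le_trans (@mean_good_bad _ _ goodr (1 + 12%:R * t) 1 _ _ _ _) _ => //.
- by rewrite card_ord.
- move=> r gr; rewrite -[X in _ + X](mean_cst (I := 'I_R')) ?card_ord // -meanD.
  apply: le_trans (@mean_good_bad _ _ (goodc r) (1 + 11%:R * t) 1 _ _ _ _) _ => //.
  + by rewrite card_ord.
  + by move=> c; have := dens1 r c; rewrite /dens; lra.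
  by have := Hgoodc r gr; rewrite card_ord; lra.
- move=> r; have : mean (fun c : 'I_R' => dens r c) <= 1 by apply: mean_le_cst.
  rewrite /dens; lra.
rewrite card_ord; lra.
Qed.

End Scales.

(** * Sets that are almost invariant under dilation *)

Local Close Scope ring_scope.
Definition prodset (N E : nat) : seq nat :=
  undup [seq \prod_(i < N) i.+1 ^ (f i) | f : {ffun 'I_N -> 'I_E.+1}].

Lemma prodsetP N E a :
  reflect (exists f : {ffun 'I_N -> 'I_E.+1}, a = \prod_(i < N) i.+1 ^ (f i))
          (a \in prodset N E).
Proof.
rewrite mem_undup; apply: (iffP mapP) => [[f _ ->]|[f ->]]; first by exists f.
by exists f; rewrite ?mem_enum.
Qed.

Lemma size_prodset N E : size (prodset N E) <= E.+1 ^ N.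
Proof.
apply: leq_trans (size_undup _) _.
by rewrite size_map -cardE card_ffun !card_ord.
Qed.

Lemma prodset_gt0 N E a : a \in prodset N E -> 0 < a.
Proof. by case/prodsetP=> f ->; rewrite prodn_gt0 // => i; rewrite expn_gt0. Qed.

Lemma mul_prodset N E z a : z < N -> a \in prodset N E -> z.+1 * a \in prodset N E.+1.
Proof.
move=> zN /prodsetP[f ->]; apply/prodsetP.
have le_E (i : 'I_N) : f i + (i == Ordinal zN) < E.+2.
  by have := ltn_ord (f i); case: (i == _) => /=; lia.
exists [ffun i => Ordinal (le_E i)].
rewrite (bigD1 (Ordinal zN)) //= [RHS](bigD1 (Ordinal zN)) //= !ffunE /= eqxx addn1 expnS mulnA.
congr (_ * _); apply: eq_bigr => i /negbTE ne.
by rewrite ffunE /= ne addn0.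
Qed.

Lemma sub_prodset N E a : a \in prodset N E -> a \in prodset N E.+1.
Proof.
move=> /prodsetP[f ->]; apply/prodsetP; exists [ffun i => widen_ord (leqnSn _) (f i)].
by apply: eq_bigr => i _; rewrite ffunE.
Qed.

Lemma prodset_neq0 N E : 0 < size (prodset N E).
Proof.
have : \prod_(i < N) i.+1 ^ ([ffun _ => ord0] : {ffun 'I_N -> 'I_E.+1}) i \in prodset N E.
  by apply/prodsetP; eexists.
by case: (prodset N E).
Qed.

(** By Bernoulli's inequality (q + 1)^q >= 2 q^q, so for E = q 2^j it suffices
    that 2^(2^j) exceeds a power of 2 whose exponent is linear in j. *)
Lemma poly_lt_exp q N : 0 < q -> exists E, q ^ E * E.+1 ^ N < q.+1 ^ E.
Proof.
move=> q0; pose k := 2 * N + N * q; pose j := 2 * k; exists (q * 2 ^ j).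
have bern m : q ^ m + m * q ^ m.-1 <= q.+1 ^ m.
  elim: m => // -[|m] IH; first by rewrite !expn1 expn0; lia.
  rewrite expnS [q.+1 ^ _]expnS; apply: leq_trans (leq_mul (leqnn _) IH).
  rewrite /= [q ^ m.+1]expnS; move: (q ^ m) => x; nia.
have two : 2 * q ^ q <= q.+1 ^ q.
  apply: leq_trans (bern q); rewrite -[X in _ + X * _](prednK q0) mulSn.
  by case: (q) q0 => // q' _; rewrite /= expnS; lia.
have hpow : 2 ^ (2 ^ j) * q ^ (q * 2 ^ j) <= q.+1 ^ (q * 2 ^ j).
  by rewrite !expnM -expnMn leq_exp2r // expn_gt0.
apply: leq_trans hpow; rewrite mulnC ltn_pmul2r ?expn_gt0 ?q0 //.
have hb : (q * 2 ^ j).+1 <= 2 ^ (q + j).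
  rewrite expnD; have := ltn_expl q (ltnSn 1); have : 0 < 2 ^ j by rewrite expn_gt0.
  by move: (2 ^ j) (2 ^ q) => x y; nia.
have hb' : (q * 2 ^ j).+1 ^ N <= 2 ^ ((q + j) * N).
  by rewrite expnM; case: (N) => // N'; rewrite leq_exp2r.
apply: leq_ltn_trans hb' _; rewrite ltn_exp2l //.
have h2 : k.+1 * k.+1 <= 2 ^ j.
  by rewrite /j mulnC expnM; apply: leq_mul; apply: ltn_expl.
apply: leq_trans h2; rewrite /j.
have [N0|N0] := posnP N; first by rewrite N0 muln0.
have k1 : 0 < k by rewrite /k; lia.
have hq : q + 2 * k <= k * (2 + q) by nia.
have : (q + 2 * k) * N <= k * (2 + q) * N by rewrite leq_mul2r hq orbT.
have -> : k * (2 + q) * N = k * k by rewrite /k; lia.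
by move: ((q + 2 * k) * N) => a; lia.
Qed.

(** Otherwise the sizes would grow exponentially. *)
Lemma exists_slow_growth N q : 0 < q ->
  exists E, q * size (prodset N E.+1) <= q.+1 * size (prodset N E).
Proof.
move=> q0; have [E hE] := poly_lt_exp N q0.
have [/existsP[e he]|/existsPn h] :=
  boolP [exists e : 'I_E, q * size (prodset N e.+1) <= q.+1 * size (prodset N e)].
  by exists e.
suff : q.+1 ^ E <= q ^ E * size (prodset N E).
  have := leq_mul (leqnn (q ^ E)) (size_prodset N E); lia.
have : forall e, e <= E -> q.+1 ^ e <= q ^ e * size (prodset N e).
  elim=> [_|e IH eE].
    by rewrite mul1n prodset_neq0.
  have := h (Ordinal eE); rewrite -ltnNge /= => he.
  have := IH (ltnW eE); rewrite expnS [q ^ _.+1]expnSr => IHe.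
  apply: (@leq_trans (q.+1 * (q ^ e * size (prodset N e)))); first by rewrite leq_mul2l IHe orbT.
  rewrite mulnCA -[leqRHS]mulnA leq_mul2l (ltnW he) orbT //.
by apply.
Qed.

(** The elements of prodset N E and their multiples by z + 1 all lie in
    prodset N E.+1, which is hardly larger for a suitable E. *)
Lemma folner N q : 0 < q ->
  exists A : seq nat, [/\ uniq A, 0 < size A, forall a, a \in A -> 0 < a &
    forall z, z < N -> q * count (fun a => z.+1 * a \notin A) A <= size A].
Proof.
move=> q0; have [E hE] := exists_slow_growth N q0.
pose A := prodset N E; exists A; split.
- exact: undup_uniq.
- exact: prodset_neq0.
- by move=> a; apply: prodset_gt0.
move=> z zN; pose B := [seq z.+1 * a | a <- A & z.+1 * a \notin A].
have uB : uniq (B ++ A).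
  rewrite cat_uniq undup_uniq andbT map_inj_uniq ?filter_uniq ?undup_uniq //=.
    by apply/hasPn => a aA; apply/negP => /mapP[b]; rewrite mem_filter => /andP[/negP nb _] e; rewrite e in aA.
  by move=> a b /eqP; rewrite eqn_mul2l => /eqP.
have sB : {subset B ++ A <= prodset N E.+1}.
  move=> a; rewrite mem_cat => /orP[/mapP[b]|]; last exact: sub_prodset.
  by rewrite mem_filter => /andP[_ bA] ->; apply: mul_prodset.
have := uniq_leq_size uB sB; rewrite size_cat size_map size_filter => h.
have := leq_trans (leq_mul (leqnn q) h) hE.
by rewrite -/A mulnDr mulSn leq_add2r.
Qed.

Local Open Scope ring_scope.

(** * From the inequality to sets of integers *)

Section Dilation.
Variable R : realFieldType.

(** The elements of A' which are not multiples z a with a in A number at most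
    |A| / q if z > 0. The last term on the left makes the bound trivial for z
    = 0. *)
Lemma dilate_count (A A' : seq nat) q N z : (0 < q)%N ->
  uniq A -> uniq A' -> {subset A' <= A} ->
  (forall z, (z < N)%N -> (q * count (fun a => (z.+1 * a)%N \notin A) A <= size A)%N) ->
  (z <= N)%N ->
  (size A')%:R - (size A)%:R / q%:R - (z == 0)%N%:R * (size A)%:R <=
  \sum_(a <- A) (((z * a)%N \in A')%:R : R).
Proof.
move=> q0 uA uA' sA hA; have qp : 0 < q%:R :> R by rewrite ltr0n.
have sA'A : (size A')%:R <= (size A)%:R :> R by rewrite ler_nat uniq_leq_size.
have sq : 0 <= (size A)%:R / q%:R :> R by rewrite divr_ge0 ?ler0n.
case: z => [|z] zN.
  apply: (@le_trans _ _ 0); first by rewrite eqxx mul1r; lra.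
  by apply: sumr_ge0 => a _; apply: ler0n.
rewrite mul0r subr0.
have -> : \sum_(a <- A) (((z.+1 * a)%N \in A')%:R : R) =
    (count (fun a => (z.+1 * a)%N \in A') A)%:R.
  by rewrite -sumn_count sumnE big_map natr_sum.
have inj : injective (muln z.+1) by move=> a b /eqP; rewrite eqn_mul2l => /eqP.
pose zA := [seq (z.+1 * a)%N | a <- A & (z.+1 * a)%N \in A].
have hz : (count (fun a => (z.+1 * a)%N \in A) A <= count (mem zA) A)%N.
  rewrite -size_filter -(size_map (muln z.+1)) -[leqRHS]size_filter.
  apply: uniq_leq_size; first by rewrite map_inj_uniq ?filter_uniq.
  move=> x /mapP[b hb ->]; move: (hb); rewrite mem_filter in hb; case/andP: hb => h1 h2 _.
  by rewrite mem_filter h1 andbT; apply: map_f; rewrite mem_filter h1.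
have hsub : (size A' <= count (fun a => (z.+1 * a)%N \in A') A + count (predC (mem zA)) A)%N.
  rewrite -!size_filter -[X in (_ <= X + _)%N](size_map (muln z.+1)) -size_cat; apply: uniq_leq_size => // a aA'.
  rewrite mem_cat orbC mem_filter /= (sA _ aA') andbT.
  case: (boolP (a \in zA)) => //= /mapP[b hb e].
  rewrite mem_filter in hb; case/andP: hb => _ bA.
  by rewrite e in aA' *; apply: map_f; rewrite mem_filter aA'.
have hq : (count (predC (mem zA)) A <= count (fun a => (z.+1 * a)%N \notin A) A)%N.
  rewrite -(leq_add2l (count (mem zA) A)) count_predC.
  apply: (@leq_trans (count (fun a => (z.+1 * a)%N \in A) A +
                      count (fun a => (z.+1 * a)%N \notin A) A)).
    by rewrite (count_predC (fun a => (z.+1 * a)%N \in A)).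
  by rewrite leq_add2r.
have h1 := hA z zN.
have {}h1 : (count (fun a => (z.+1 * a)%N \notin A) A)%:R <= (size A)%:R / q%:R :> R.
  by rewrite ler_pdivlMr // -natrM ler_nat mulnC.
have : (size A')%:R <= (count (fun a => (z.+1 * a)%N \in A') A)%:R +
   (count (fun a => (z.+1 * a)%N \notin A) A)%:R :> R.
  by rewrite -natrD ler_nat; apply: leq_trans hsub _; rewrite leq_add2l.
lra.
Qed.

Lemma sum_mean (T : Type) (s : seq T) (I : finType) (F : T -> I -> R) :
  \sum_(a <- s) mean (F a) = mean (fun i => \sum_(a <- s) F a i).
Proof. by rewrite /mean -mulr_suml exchange_big. Qed.

Lemma mean_zero_le n m : (0 < n)%N -> (0 < m)%N ->
  mean (fun i : 'I_n => ((m * i == 0)%N%:R : R)) <= n%:R^-1.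
Proof.
case: n => // n _ m0; rewrite /mean card_ord ler_piMl ?invr_ge0 ?ler0n //.
rewrite big_ord_recl /= muln0 eqxx big1 ?addr0 // => i _.
by rewrite muln_eq0 (gtn_eqF m0).
Qed.

(** [scale_average] for the sets {k : k a in A'}, summed over a in A. *)
Lemma exists_no_large_sumfree p : (0 < p)%N ->
  exists A : seq nat, [/\ uniq A, (0 < size A)%N, forall a, a \in A -> (0 < a)%N &
    forall A' : seq nat, uniq A' -> {subset A' <= A} ->
      sumfree_nat (mem A') -> 3%:R * (size A')%:R <= (1 + 19%:R / p%:R) * (size A)%:R :> R].
Proof.
move=> p0.
pose K := (64 * p ^ 4)%N; pose H := K`!.
pose M := (64 * p ^ 5)%N; pose R' := (2 * p * 2 ^ M)%N.
pose Rg := (p * (1024 * p ^ 8 * H ^ R'))%N; pose W := (Rg * R' + 2)%N.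
pose N := (4 * p ^ 2 * H ^ (Rg.+1 * W))%N.
have KH : (K <= H)%N by apply: fact_geq.
have hH d : (1 < d < K)%N -> (d %| H)%N.
  by case/andP=> d1 dK; apply: dvdn_fact; rewrite (ltnW dK) (ltnW d1).
have hav S := @scale_average R p H K R' M Rg W N S p0 (erefl _) KH hH (erefl _) (erefl _)
   (erefl _) (erefl _) (erefl _).
have hlev := @level_facts R' Rg W (erefl _).
have pH : (p <= H)%N.
  apply: leq_trans KH; rewrite /K (@leq_trans (p ^ 4)) ?leq_pmull //.
  by rewrite -{1}[p]expn1 leq_pexp2l.
have H0 : (0 < H)%N by apply: leq_trans pH.
have HN : (H ^ (Rg.+1 * W) <= N)%N by rewrite leq_pmull // muln_gt0 expn_gt0 p0.
have pN : (p <= N)%N by rewrite /N expnS -!mulnA mulnCA leq_pmulr // !muln_gt0 !expn_gt0 p0 H0.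
have R'0 : (0 < R')%N by rewrite !muln_gt0 expn_gt0 p0.
have Rg0 : (0 < Rg)%N by rewrite /Rg muln_gt0 p0 muln_gt0 expn_gt0 H0 muln_gt0 expn_gt0 p0.
have {KH hH}[A [uA A0 Apos hA]] := folner N p0.
exists A; split=> // A' uA' sA' sfA'.
(* Only the properties of the parameters collected above matter from here
   on. *)
move: (K) (H) (M) (R') (Rg) (W) (N) hav hlev pH H0 HN pN R'0 Rg0 hA.
clear K H M R' Rg W N => K H M R' Rg W N hav hlev pH H0 HN pN R'0 Rg0 hA.
have pp : 0 < p%:R :> R by rewrite ltr0n.
have Sf a : a \in A -> sumfree_nat (fun k => (k * a)%N \in A').
  by move=> aA x y /= xA yA; rewrite mulnDl; apply: sfA'.
have tot : \sum_(a <- A) (mean (fun r : 'I_Rg => mean (fun c : 'I_R' =>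
     prog_density R (fun k => (k * a)%N \in A') H (r * R' + c) (level Rg W r - (r * R' + c))))
  + 2%:R * mean (fun x : 'I_N => ((x * a)%N \in A')%:R)) <= (size A)%:R * (1 + 13%:R * p%:R^-1).
  have -> : (size A)%:R * (1 + 13%:R * p%:R^-1) = \sum_(a <- A) (1 + 13%:R * p%:R^-1) :> R.
    by rewrite big_const_seq count_predT iter_addr_0 mulr_natl.
  by rewrite big_seq [leRHS]big_seq; apply: ler_sum => a aA; apply: hav; apply: Sf.
move: tot; rewrite big_split /= -mulr_sumr !sum_mean.
have dil z : (z <= N)%N -> (size A')%:R - (size A)%:R / p%:R - (z == 0)%N%:R * (size A)%:R <=
    \sum_(a <- A) (((z * a)%N \in A')%:R : R) by move=> zN; apply: dilate_count hA zN.
pose X : R := (size A')%:R - (size A)%:R / p%:R - (size A)%:R / p%:R.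
have dilm n m : (0 < m)%N -> (p <= n)%N -> (forall k, (k < n)%N -> (m * k <= N)%N) ->
    X <= mean (fun k : 'I_n => \sum_(a <- A) (((m * k * a)%N \in A')%:R : R)).
  move=> m0 pn mN; apply: le_trans (le_mean (fun k : 'I_n => dil _ (mN _ (ltn_ord k)))).
  have n0 : (0 < n)%N by apply: leq_trans pn.
  rewrite meanB mean_cst ?card_ord // lerD2l lerN2.
  under eq_mean => k do rewrite mulrC.
  rewrite meanZ ler_wpM2l ?ler0n //; apply: le_trans (mean_zero_le n0 m0) _.
  by rewrite lef_pV2 ?posrE ?ltr0n // ler_nat.
have h1 : X <= mean (fun x : 'I_N => \sum_(a <- A) (((x * a)%N \in A')%:R : R)).
  have := dilm N 1%N isT pN; under eq_mean => k do under eq_bigr => a _ do rewrite mul1n.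
  by apply=> k kN; rewrite mul1n ltnW.
have h2 : X <= mean (fun r : 'I_Rg => \sum_(a <- A) mean (fun c : 'I_R' =>
     prog_density R (fun k => (k * a)%N \in A') H (r * R' + c) (level Rg W r - (r * R' + c)))).
  rewrite -[X](mean_cst (I := 'I_Rg)) ?card_ord //; apply: le_mean => r.
  rewrite sum_mean -[X](mean_cst (I := 'I_R')) ?card_ord //; apply: le_mean => c.
  rewrite /prog_density sum_mean; have [f1 f2 f3 f4] := hlev r (ltn_ord r).
  have lt_c : (r * R' + c < level Rg W r)%N.
    have := ltn_ord c; move: f2 f3; clear.
    by move: (r * R')%N (level Rg W r) (level Rg W r.+1) => a b d; lia.
  have pos : (0 < level Rg W r - (r * R' + c))%N by rewrite subn_gt0.
  apply: dilm; first by rewrite expn_gt0 H0.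
    by apply: leq_trans pH _; rewrite -{1}[H]expn1 leq_pexp2l.
  move=> k kH; apply: leq_trans HN; apply: (@leq_trans (H ^ level Rg W r)).
    by rewrite -(subnKC (ltnW lt_c)) (expnD H (r * R' + c)) leq_mul2l ltnW ?orbT.
  by rewrite leq_pexp2l.
move=> tot; have : 3%:R * X <= (size A)%:R * (1 + 13%:R * p%:R^-1).
  by apply: le_trans tot; lra.
rewrite /X; lra.
Qed.
End Dilation.

Section AllSizes.
Variable R : realFieldType.

Lemma sumfree_scale (A' : seq nat) d : sumfree_nat (mem A') ->
  sumfree_nat (fun a => (d * a)%N \in A').
Proof. by move=> sf x y /= xA yA; rewrite mulnDr; apply: sf. Qed.

Lemma sumfree_filter (A' : seq nat) (P : pred nat) : sumfree_nat (mem A') ->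
  sumfree_nat (mem [seq a <- A' | P a]).
Proof.
move=> sf x y; rewrite !inE !mem_filter => /andP[_ xA] /andP[_ yA].
by rewrite negb_and (sf _ _ xA yA) orbT.
Qed.

(** The elements of A are below D, so the dilates of A by the powers of D lie
    in disjoint intervals; a sum-free set meets each of them in the dilate of
    a sum-free subset of A. *)
Lemma dilated_copies (A : seq nat) D (c : R) k :
  uniq A -> {in A, forall a, (0 < a < D)%N} -> (0 < D)%N -> 0 <= c ->
  (forall A' : seq nat, uniq A' -> {subset A' <= A} -> sumfree_nat (mem A') ->
     3%:R * (size A')%:R <= c * (size A)%:R) ->
  exists U : seq nat, [/\ uniq U, size U = (k * size A)%N, {in U, forall a, (0 < a < D ^ k)%N} &
    forall A' : seq nat, uniq A' -> {subset A' <= U} -> sumfree_nat (mem A') ->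
     3%:R * (size A')%:R <= c * (size U)%:R].
Proof.
move=> uA AD D0 c0 hA; elim: k => [|k [U [uU szU UD hU]]].
  exists [::]; split=> // -[|a A'] _ sA' _; first by rewrite !mulr0.
  by have := sA' a (mem_head _ _).
have inj : injective (muln (D ^ k)).
  by move=> a b /eqP; rewrite eqn_pmul2l ?expn_gt0 ?D0 // => /eqP.
pose Z := [seq (D ^ k * a)%N | a <- A].
have ZD a : a \in Z -> (D ^ k <= a < D ^ k.+1)%N.
  move=> /mapP[b /AD /andP[b0 bD] ->]; rewrite leq_pmulr //=.
  by rewrite expnSr ltn_pmul2l // expn_gt0 D0.
have disj a : a \in U -> a \in Z = false.
  by move=> /UD /andP[_ aD]; apply/negP => /ZD /andP[]; rewrite leqNgt aD.
exists (U ++ Z); split.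
- rewrite cat_uniq uU map_inj_uniq // uA andbT; apply/hasPn => a aZ.
  by apply/negP => /disj; rewrite aZ.
- by rewrite size_cat szU size_map mulSn addnC.
- move=> a; rewrite mem_cat => /orP[/UD /andP[a0 aD]|/ZD /andP[a1 a2]].
    by rewrite a0 (leq_trans aD) // leq_pexp2l.
  by rewrite a2 andbT (leq_trans _ a1) // expn_gt0 D0.
move=> A' uA' sA' sf.
pose A1 := [seq a <- A' | a \in U]; pose A2 := [seq a <- A | (D ^ k * a)%N \in A'].
have h1 : 3%:R * (size A1)%:R <= c * (size U)%:R.
  apply: hU; rewrite ?filter_uniq //; last exact: sumfree_filter.
  by move=> a; rewrite mem_filter => /andP[].
have h2 : 3%:R * (size A2)%:R <= c * (size A)%:R.
  apply: hA; rewrite ?filter_uniq //.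
    by move=> a; rewrite mem_filter => /andP[].
  move=> x y; rewrite !inE !mem_filter => /andP[xA _] /andP[yA _].
  by rewrite negb_and (sumfree_scale sf xA yA).
have h3 : (size A' <= size A1 + size A2)%N.
  rewrite -(size_map (muln (D ^ k)) A2) -size_cat; apply: uniq_leq_size => // a aA'.
  rewrite mem_cat mem_filter aA' andbT; have := sA' _ aA'; rewrite mem_cat.
  case/orP=> [->//|/mapP[b bA e]]; rewrite e in aA' *.
  by apply/orP; right; apply: map_f; rewrite mem_filter aA'.
have : (size A')%:R <= (size A1)%:R + (size A2)%:R :> R by rewrite -natrD ler_nat.
rewrite size_cat size_map natrD mulrDr; lra.
Qed.

(** Copies of A, and fewer than |A| further integers. *)
Lemma exists_all_sizes p : (0 < p)%N ->
  exists N, forall n, (N <= n)%N -> exists A : seq nat,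
    [/\ uniq A, size A = n, {in A, forall a, (0 < a)%N} &
      forall A' : seq nat, uniq A' -> {subset A' <= A} -> sumfree_nat (mem A') ->
      3%:R * (size A')%:R <= (1 + 20%:R / p%:R) * n%:R :> R].
Proof.
move=> p0; have [A [uA A0 Apos hA]] := exists_no_large_sumfree R p0.
have pp : 0 < p%:R :> R by rewrite ltr0n.
pose D := (\sum_(a <- A) a).+1.
have AD : {in A, forall a, (0 < a < D)%N}.
  by move=> a aA; rewrite Apos // ltnS (big_rem a) //= leq_addr.
exists (3 * size A * p)%N => n hn.
pose k := (n %/ size A)%N; pose r := (n %% size A)%N.
have nE : n = (k * size A + r)%N := divn_eq _ _.
have rA : (r < size A)%N by rewrite ltn_mod.
have c0 : 0 <= 1 + 19%:R / p%:R :> R by rewrite addr_ge0 // divr_ge0 // ltW.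
have [U [uU szU UD hU]] := dilated_copies k uA AD (ltn0Sn _) c0 hA.
exists (U ++ iota (D ^ k) r); split.
- rewrite cat_uniq uU iota_uniq andbT; apply/hasPn => a; rewrite mem_iota => /andP[a1 _].
  by apply/negP => /UD /andP[_]; rewrite ltnNge a1.
- by rewrite size_cat szU size_iota.
- move=> a; rewrite mem_cat mem_iota => /orP[/UD/andP[]//|/andP[a1 _]].
  by rewrite (leq_trans _ a1) // expn_gt0.
move=> A' uA' sA' sf; pose A1 := [seq a <- A' | a \in U].
have h1 : 3%:R * (size A1)%:R <= (1 + 19%:R / p%:R) * (size U)%:R :> R.
  apply: hU; rewrite ?filter_uniq //; last exact: sumfree_filter.
  by move=> a; rewrite mem_filter => /andP[].
have h2 : (size A' <= size A1 + r)%N.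
  rewrite -(size_iota (D ^ k) r) -size_cat; apply: uniq_leq_size => // a aA'.
  by rewrite mem_cat mem_filter aA' andbT -mem_cat sA'.
have {}h2 : (size A')%:R <= (size A1)%:R + (size A)%:R :> R.
  by rewrite -natrD ler_nat (leq_trans h2) // leq_add2l ltnW.
have h3 : (size U)%:R <= n%:R :> R by rewrite ler_nat szU [X in (_ <= X)%N]nE leq_addr.
have h4 : 3%:R * (size A)%:R <= n%:R / p%:R :> R.
  by rewrite ler_pdivlMr // -!natrM ler_nat.
have := ler_wpM2l c0 h3; lra.
Qed.
End AllSizes.

Definition sumfree_bound (n m : nat) : Prop :=
  exists A : seq nat, [/\ uniq A, size A = n, {in A, forall a, (0 < a)%N} &
    forall A' : seq nat, uniq A' -> {subset A' <= A} -> sumfree_nat (mem A') -> (size A' <= m)%N].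

Lemma sumfree_boundn n : sumfree_bound n n.
Proof.
exists (iota 1 n); split; rewrite ?iota_uniq ?size_iota //.
  by move=> a; rewrite mem_iota => /andP[].
by move=> A' uA' sA' _; rewrite -[leqRHS](size_iota 1) uniq_leq_size.
Qed.

Lemma sumfree_bound_fset n m : sumfree_bound n m ->
  exists A : {fset int}, [/\ #|` A|%fset = n, forall a : int, a \in A -> 0 < a &
    forall B : {fset int}, (B `<=` A)%fset -> sum_free B -> (#|` B|%fset <= m)%N].
Proof.
case=> A [uA szA Apos hA]; pose i : nat -> int := Posz.
have ui : uniq (map i A) by rewrite map_inj_uniq // => a b [].
exists (seq_fset tt (map i A)); split.
- by rewrite size_seq_fset undup_id // size_map.
- by move=> a; rewrite seq_fsetE => /mapP[b /Apos b0 ->].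
move=> B sB sf; pose B' := [seq a <- A | i a \in B].
have -> : (#|` B|%fset = size B')%N.
  have -> : size B' = size (map i B') by rewrite size_map.
  apply/eqP; rewrite eqn_leq; apply/andP; split; apply: uniq_leq_size.
  - exact: fset_uniq.
  - move=> a aB; have := fsubsetP sB _ aB; rewrite seq_fsetE => /mapP[b bA e].
    by rewrite e in aB *; apply: map_f; rewrite mem_filter aB.
  - by rewrite map_inj_uniq ?filter_uniq // => a b [].
  - by move=> a /mapP[b hb ->]; move: hb; rewrite mem_filter => /andP[].
apply: hA; rewrite ?filter_uniq //.
  by move=> a; rewrite mem_filter => /andP[].
move=> x y; rewrite !inE !mem_filter => /andP[xB _] /andP[yB _].
by apply/negP => /andP[xyB _]; apply: (sf _ _ _ xB yB xyB); rewrite /i PoszD.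
Qed.

From mathcomp Require Import boolp classical_sets reals topology normedtype sequences.
Import Order.TTheory GRing.Theory Num.Theory numFieldNormedType.Exports.
Local Open Scope classical_set_scope.

Theorem theorem1p1 (R : realType) :
  exists err : nat -> R,
    ((fun n : nat => err n / n%:R) @ \oo --> (0 : R)) /\
    forall n : nat, (0 < n)%N ->
      exists A : {fset int},
        [/\ #|` A| = n,
            forall a : int, a \in A -> 0 < a &
            forall B : {fset int}, (B `<=` A)%fset -> sum_free B ->
              #|` B|%:R <= 3^-1 * n%:R + err n].
Proof.
have ex_m n : exists m, `[< sumfree_bound n m >] by exists n; apply/asboolP/sumfree_boundn.
pose m n := ex_minn (ex_m n).
have mP n : sumfree_bound n (m n) by rewrite /m; case: ex_minnP => k /asboolP.
have m_min n k : sumfree_bound n k -> (m n <= k)%N.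
  by rewrite /m; case: ex_minnP => l _ + /asboolP h; apply.
(* The best bound over all sets of size n may a priori be below n / 3, so the
   error is truncated at 0. *)
pose err n : R := Num.max 0 ((m n)%:R - 3^-1 * n%:R).
exists err; split; last first.
  move=> n _; have [A [cA Apos hA]] := sumfree_bound_fset (mP n).
  exists A; split=> // B sB sf; apply: (@le_trans _ _ (m n)%:R); first by rewrite ler_nat hA.
  by rewrite -lerBlDl le_max lexx orbT.
apply/cvgrPdist_le => eps eps0.
have [p hp] : exists p : nat, 7%:R / eps < p%:R by exists (Num.bound (7%:R / eps)); apply: archi_boundP; rewrite divr_ge0 ?(ltW eps0).
have p0 : (0 < p)%N.
  by rewrite -(ltr_nat R); apply: le_lt_trans hp; rewrite divr_ge0 ?(ltW eps0).
have pp : 0 < p%:R :> R by rewrite ltr0n.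
have [N hN] := exists_all_sizes R p0.
exists N.+1 => // n /= Nn.
have n0 : 0 < n%:R :> R by rewrite ltr0n; apply: leq_ltn_trans Nn.
rewrite sub0r normrN ger0_norm; last by rewrite divr_ge0 ?ler0n // le_max lexx.
rewrite ler_pdivrMr // ge_max mulr_ge0 ?ler0n ?(ltW eps0) //=.
pose x : R := (1 + 20%:R / p%:R) * n%:R / 3%:R.
have x0 : 0 <= x by rewrite /x divr_ge0 // mulr_ge0 ?ler0n // addr_ge0 // divr_ge0 ?ler0n.
have bnd : sumfree_bound n (Num.truncn x).
  have [A [uA szA Apos hA]] := hN n (ltnW Nn); exists A; split=> // A' uA' sA' sf.
  by rewrite truncn_ge_nat // /x ler_pdivlMr // mulrC hA.
have mx : (m n)%:R <= x by rewrite -truncn_ge_nat // m_min.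
have p7 : 7%:R / p%:R <= eps.
  by rewrite ler_pdivrMr // mulrC -ler_pdivrMr // ltW.
have := ler_wpM2r (ltW n0) p7; have : 0 <= n%:R / p%:R :> R by rewrite divr_ge0 ?ler0n.
move: mx; rewrite /x; lra.
Qed.
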